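(* Let $M\in\mathbb{R}^{d\times d}$ and $\theta\in\mathbb{R}^d$. At each time $t\ge1$ a learner pulls an arm $x_t$ from a bounded set $D\subset\mathbb{R}^d$ containing the unit sphere and observes $r_t(x_t):=(M^t\theta)^\top x_t+\eta_t$, where the noise is conditionally $R$-sub-Gaussian ($R\ge0$): there is an increasing filtration $(\mathcal{F}_\tau)$ with $x_1,\dots,x_{\tau+1},\eta_1,\dots,\eta_\tau$ $\mathcal{F}_\tau$-measurable, $\mathbb{E}[\eta_t\mid\mathcal{F}_{t-1}]=0$, $\mathrm{Var}[\eta_t\mid\mathcal{F}_{t-1}]\le R^2$, $\mathbb{E}[e^{\lambda\eta_t}\mid\mathcal{F}_{t-1}]\le e^{\lambda^2R^2/2}$ for all $\lambda$. Assume $\{M^t\theta\}_{t\ge1}$ lies in the ball of radius $B>0$ and $(M^t\theta)_{t=t_0}^\infty$ is $\mu$-nearly periodic of length $L$ for some $t_0>0$, $\mu\ge0$, $L\in\mathbb{Z}_{>0}$. Given $\delta\in(0,1]$, let $N$ be an integer with $N\ge2d^2$ and \[N\ge\max\left\{16L^2,\ \frac{-(d-1)\log\Delta}{\Delta}+\frac{\log(B\kappa^2)+d+6}{\Delta}+d\right\},\qquad \gamma(N):=\frac{\sqrt{4d^2R^2\log(4d^2/\delta)}+1}{\sqrt N}.\] Run Algorithm 2: draw $\tilde x_1,\dots,\tilde x_d$ independently and uniformly from the unit sphere of $\mathbb{R}^d$; during times $1,\dots,N$ the observations are not used; for $t=N+1,\dots,N+2Nd^2$ let $m_0:=((t-N-1)\bmod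 2d^2)+1$, $m:=\lceil m_0/(2d)\rceil$, pull $x_t=\tilde x_m$ and observe $r_t(\tilde x_m)$. For $s=0,1$ form $A_s(N)\in\mathbb{C}^{d\times d}$ with $(k,\ell)$ entry $\frac1N\sum_{j=0}^{N-1}r_{2(k-1)d+sd+2d^2j+N+\ell}(\tilde x_k)e^{i2\pi j^2/(4L)}$; let $\hat A_0(N)$ be the low rank approximation of $A_0(N)$ via the singular value threshold $\gamma(N)$, and output $A_1(N)\hat A_0(N)^\dagger$. Then there exists a matrix $A$ whose eigenvalues are zero except for $(\theta,1,d)$-distinct eigenvalues of $M$ such that, with probability at least $1-\delta$, \[\left\|A-A_1(N)\hat A_0(N)^\dagger\right\|\le C\,\frac{R^2(\log(1/\delta)+1)+1}{\sqrt N},\] where $C>0$ is a constant depending on $\theta$, $M$, $d$, $(\tilde x_m)_{m=1}^d$, and $L$ (through the constants in the bounds on the Weyl sums $\sum_{j=0}^{N}e^{i2\pi(2bj+j^2)/(4L)}$).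
   Context: $\|\cdot\|$ is the spectral norm and $\dagger$ the Moore–Penrose pseudoinverse. A sequence $(y_t)$ in $\mathbb{R}^d$ is $\mu$-nearly periodic of length $L$ if $\|y_{s+Lt}-y_s\|<\mu$ for all $s,t\in\mathbb{Z}_{>0}$. $\kappa:=\inf\{\|P\|\|P^{-1}\|: P^{-1}MP=J_M\}\ge1$ where $J_M$ is a Jordan normal form of $M$; $\Delta\in(0,1]$ is such that every eigenvalue $\alpha$ of $M$ with $|\alpha|<1$ satisfies $|\alpha|\le1-\Delta$. Low rank approximation via singular value threshold $\gamma$: if $A=U\,\mathrm{diag}(\sigma_1,\dots,\sigma_r,0,\dots)V^*$ is an SVD, $A_\gamma:=U\,\mathrm{diag}(\mathbf{1}_{[\gamma,\infty)}(\sigma_1)\sigma_1,\dots,\mathbf{1}_{[\gamma,\infty)}(\sigma_r)\sigma_r,0,\dots)V^*$. Let $W:=\mathrm{span}_{\mathbb{C}}\{M\theta,M^2\theta,\dots\}$; for $k\in\mathbb{Z}_{>0}$, a $(\theta,1,k)$-distinct eigenvalue of $M$ is an eigenvalue $\beta$ of $M^k|_W$ with $|\beta|=1$ and $\theta_\beta\ne0$, where $\theta_\beta$ is the component of $\theta$ in the generalized eigenspace of $M^k$ for $\beta$. *)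

(* Defs.v *)
From HB Require Import structures.
From mathcomp Require Import all_boot all_order all_algebra.
From mathcomp Require Import complex.
From mathcomp Require Import all_classical all_reals all_analysis.

Set Implicit Arguments.
Unset Strict Implicit.
Unset Printing Implicit Defensive.

Import Order.TTheory GRing.Theory Num.Theory.
Import numFieldNormedType.Exports.
Local Open Scope classical_set_scope.
Local Open Scope ring_scope.
Local Open Scope sesquilinear_scope.

Section linear_algebra.
Variable R : realType.
Local Notation C := R[i].

Definition vnorm (d : nat) (v : 'cV[R]_d) : R :=
  Num.sqrt (\sum_(i < d) v i 0 ^+ 2).

Definition unit_sphere (d : nat) : set 'cV[R]_d := [set v | vnorm v = 1].

Definition cvnorm (d : nat) (v : 'cV[C]_d) : R :=
  Num.sqrt (\sum_(i < d) Normc.normc (v i 0) ^+ 2).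

Definition spectral_norm (m n : nat) (A : 'M[C]_(m, n)) : R :=
  sup [set cvnorm (A *m v) | v in [set v : 'cV[C]_n | cvnorm v = 1]].

Definition cmx (m n : nat) (A : 'M[R]_(m, n)) : 'M[C]_(m, n) :=
  map_mx (real_complex R) A.

(* The four Penrose equations; they have exactly one solution X, so the default
   value 0 in pinv plays no role. *)
Definition penrose (m n : nat) (A : 'M[C]_(m, n)) (X : 'M[C]_(n, m)) : Prop :=
  [/\ A *m X *m A = A, X *m A *m X = X,
      (A *m X)^t* = A *m X & (X *m A)^t* = X *m A].

Definition pinv (m n : nat) (A : 'M[C]_(m, n)) : 'M[C]_(n, m) :=
  xget 0 [set X | penrose A X].

Definition diag_real (n : nat) (s : 'I_n -> R) : 'M[C]_n :=
  diag_mx (\row_i (s i)%:C%C).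

Definition is_svd (n : nat) (A U : 'M[C]_n) (s : 'I_n -> R) (V : 'M[C]_n) :
    Prop :=
  [/\ U \is unitarymx, V \is unitarymx, (forall i, 0 <= s i) &
      A = U *m diag_real s *m V^t*].

(* Every A has a singular value decomposition and the thresholded matrix does
   not depend on which one is taken, so xget selects a single value. *)
Definition low_rank_approx (n : nat) (gamma : R) (A : 'M[C]_n) : 'M[C]_n :=
  xget 0 [set B | exists U s V, is_svd A U s V /\
    B = U *m diag_real (fun i => if gamma <= s i then s i else 0) *m V^t*].

(* Entrywise form of a block-diagonal matrix of upper Jordan blocks: 0 off the
   diagonal and the superdiagonal, and each superdiagonal entry is 0 (between
   two blocks) or 1 (inside a block, where the diagonal is constant). *)
Definition jordan_normal (n : nat) (J : 'M[C]_n) : Prop :=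
  forall i j : 'I_n,
    (j != i -> j != i.+1 :> nat -> J i j = 0) /\
    (j = i.+1 :> nat -> J i j = 0 \/ (J i j = 1 /\ J i i = J j j)).

Definition jordan_transition (n : nat) (M J : 'M[C]_n) : set 'M[C]_n :=
  [set Q | Q \in unitmx /\ invmx Q *m M *m Q = J].

Definition is_jordan_form (n : nat) (M J : 'M[C]_n) : Prop :=
  jordan_normal J /\ jordan_transition M J !=set0.

Definition kappa (n : nat) (M J : 'M[C]_n) : R :=
  inf [set spectral_norm Q * spectral_norm (invmx Q) |
       Q in jordan_transition M J].

Definition nearly_periodic (d : nat) (y : nat -> 'cV[R]_d) (mu : R) (L : nat) :
    Prop :=
  forall s t : nat, (0 < s)%N -> (0 < t)%N ->
    vnorm (y (s + L * t)%N - y s) < mu.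

Definition orbit_span (d : nat) (M : 'M[C]_d) (theta : 'cV[C]_d) :
    set 'cV[C]_d :=
  [set v | exists (n : nat) (c : 'I_n -> C),
     v = \sum_(j < n) c j *: (M ^+ j.+1 *m theta)].

(* u is the component of v in the generalized eigenspace of A for beta, along
   the decomposition of C^d into generalized eigenspaces; the summation list s
   may contain numbers that are not eigenvalues, whose summand is then 0. *)
Definition gen_eigen_component (d : nat) (A : 'M[C]_d) (v : 'cV[C]_d)
    (beta : C) (u : 'cV[C]_d) : Prop :=
  exists (s : seq C) (f : C -> 'cV[C]_d),
    [/\ uniq s /\ beta \in s,
        (forall a, (A - a%:M) ^+ d *m f a = 0),
        v = \sum_(a <- s) f a & u = f beta].

(* beta is a (theta, 1, k)-distinct eigenvalue of M; the first two conjuncts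
   say that beta is a unimodular eigenvalue of M ^ k restricted to W. *)
Definition distinct_eigenvalue (d : nat) (M : 'M[R]_d) (theta : 'cV[R]_d)
    (k : nat) (beta : C) : Prop :=
  [/\ (exists v, [/\ v != 0, orbit_span (cmx M) (cmx theta) v &
                     cmx M ^+ k *m v = beta *: v]),
      Normc.normc beta = 1 &
      (exists2 u, gen_eigen_component (cmx M ^+ k) (cmx theta) beta u & u != 0)].

(* exp(i 2 pi j^2 / (4 L)) *)
Definition weyl_weight (L j : nat) : C :=
  let phi : R := 2 * pi * (j ^ 2)%N%:R / (4 * L)%N%:R in
  (cos phi +i* sin phi)%C.

End linear_algebra.

Section probability.
Context {R : realType} {dO : measure_display} {Omega : measurableType dO}.
Variable P : probability Omega R.

(* Borel sets of R^d, as the sigma-algebra generated by the coordinates. *)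
Definition borel_vec (d : nat) : set (set 'cV[R]_d) :=
  g_sigma_preimage (fun (i : 'I_d) (v : 'cV[R]_d) => v i 0).

Definition vec_measurable (G : set (set Omega)) (d : nat)
    (X : Omega -> 'cV[R]_d) : Prop :=
  forall B, borel_vec B -> G (X @^-1` B).

Definition real_measurable (G : set (set Omega)) (X : Omega -> R) : Prop :=
  forall B : set R, measurable B -> G (X @^-1` B).

(* The uniform law on the unit sphere is the only rotation-invariant
   probability measure carried by it. *)
Definition uniform_sphere (d : nat) (X : Omega -> 'cV[R]_d) : Prop :=
  [/\ vec_measurable measurable X,
      (forall w, unit_sphere (X w)) &
      forall (O : 'M[R]_d) (B : set 'cV[R]_d), O^T *m O = 1%:M ->
        borel_vec B -> P [set w | B (O *m X w)] = P [set w | B (X w)]].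

(* Taking some of the sets B i to be setT gives all subfamilies. *)
Definition independent_vecs (n d : nat) (X : 'I_n -> Omega -> 'cV[R]_d) :
    Prop :=
  forall B : 'I_n -> set 'cV[R]_d, (forall i, borel_vec (B i)) ->
    P (\bigcap_i (X i @^-1` B i)) = (\prod_(i < n) P (X i @^-1` B i))%E.

(* Y is a version of E[X | G]. *)
Definition is_condexp (G : set (set Omega)) (X Y : Omega -> R) : Prop :=
  [/\ P.-integrable setT (EFin \o X), P.-integrable setT (EFin \o Y),
      real_measurable G Y &
      forall A, G A ->
        (\int[P]_(w in A) (Y w)%:E = \int[P]_(w in A) (X w)%:E)%E].

(* V is a version of Var[X | G] = E[(X - E[X | G])^2 | G]. *)
Definition is_condvar (G : set (set Omega)) (X V : Omega -> R) : Prop :=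
  exists2 Y, is_condexp G X Y &
    is_condexp G (fun w => (X w - Y w) ^+ 2) V.

Definition filtration (F : nat -> set (set Omega)) : Prop :=
  [/\ (forall t, sigma_algebra setT (F t)),
      (forall t, F t `<=` measurable) &
      (forall s t, (s <= t)%N -> F s `<=` F t)].

(* sigma is the sub-Gaussian parameter of the noise eta 1, eta 2, ... ; the
   values x 0 and eta 0 are unused. *)
Definition cond_subgaussian (d : nat) (F : nat -> set (set Omega)) (sigma : R)
    (x : nat -> Omega -> 'cV[R]_d) (eta : nat -> Omega -> R) : Prop :=
  filtration F /\
  (forall tau s, (1 <= s <= tau.+1)%N -> vec_measurable (F tau) (x s)) /\
  (forall tau s, (1 <= s <= tau)%N -> real_measurable (F tau) (eta s)) /\
  forall t, (1 <= t)%N ->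
    [/\ (exists2 Y, is_condexp (F t.-1) (eta t) Y & {ae P, forall w, Y w = 0}),
        (exists2 V, is_condvar (F t.-1) (eta t) V &
           {ae P, forall w, V w <= sigma ^+ 2}) &
        forall lambda : R,
          exists2 Y, is_condexp (F t.-1) (fun w => expR (lambda * eta t w)) Y &
            {ae P, forall w, Y w <= expR (lambda ^+ 2 * sigma ^+ 2 / 2)}].

End probability.

Section algorithm.
Variable R : realType.

Definition ceil_div (m n : nat) : nat := ((m + n.-1) %/ n)%N.

(* r_t(z), on the sample where the noise takes the values eta t. *)
Definition reward (d : nat) (M : 'M[R]_d) (theta : 'cV[R]_d) (eta : nat -> R)
    (t : nat) (z : 'cV[R]_d) : R :=
  ((M ^+ t *m theta)^T *m z) 0 0 + eta t.

(* A_s(N). The indices k, l : 'I_d are the one-based row and column numbers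
   minus 1, whence l.+1 and the factor k for (row number - 1). *)
Definition data_matrix (d : nat) (M : 'M[R]_d) (theta : 'cV[R]_d)
    (L N : nat) (eta : nat -> R) (xt : 'I_d -> 'cV[R]_d) (s : nat) :
    'M[R[i]]_d :=
  \matrix_(k < d, l < d)
    ((N%:R)^-1 * \sum_(j < N)
       (reward M theta eta
         (2 * k * d + s * d + 2 * d ^ 2 * j + N + l.+1)%N (xt k))%:C%C
       * weyl_weight R L j).

Definition threshold (d : nat) (sigma delta : R) (N : nat) : R :=
  (Num.sqrt (4 * d%:R ^+ 2 * sigma ^+ 2 * ln (4 * d%:R ^+ 2 / delta)) + 1)
    / Num.sqrt N%:R.

Definition algorithm_output (d : nat) (M : 'M[R]_d) (theta : 'cV[R]_d)
    (L N : nat) (sigma delta : R) (eta : nat -> R) (xt : 'I_d -> 'cV[R]_d) :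
    'M[R[i]]_d :=
  data_matrix M theta L N eta xt 1 *m
  pinv (low_rank_approx (threshold d sigma delta N)
          (data_matrix M theta L N eta xt 0)).

(* The arms pulled at times N + 1, ..., N + 2 N d^2, with m.+1 the one-based
   index of the direction used at time t. *)
Definition exploration (Omega : Type) (d N : nat)
    (x : nat -> Omega -> 'cV[R]_d) (xt : 'I_d -> Omega -> 'cV[R]_d) : Prop :=
  forall (t : nat) (m : 'I_d), (N + 1 <= t <= N + 2 * N * d ^ 2)%N ->
    (m.+1 = ceil_div ((t - N - 1) %% (2 * d ^ 2) + 1) (2 * d))%N ->
    forall w, x t w = xt m w.

End algorithm.

(* Main.v *)
(** Let [rho = beta ^ d].  The trajectory is [M^t theta = \sum_beta beta^t u_beta + O(tau^t)],
the sum running over unimodular eigenvalues: polynomials in [M] project the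
bounded orbit onto generalized eigenspaces, where boundedness kills the growing
components and the Jordan chains of modulus one.  Averaging against the
[2L]-periodic Weyl weights replaces [beta^(2 d^2 j)] by a constant [c_beta] up to
O(1/N), so that, up to noise and O(1/N), [A_0 = P D Q] and [A_1 = P Lam D Q], where
[P] has the entries [rho^(2k) <u_beta, x_k>], [Lam = diag(rho)],
[D = diag(c_beta beta^N)] and [Q] is of Vandermonde type; the [beta] with
[c_beta = 0] are dropped.  The limit is [A = P Lam P^+], whose spectrum lies in
[{0} u {rho}].

Almost surely [P] has full column rank: its leading minors are, one direction at
a time, nonzero linear forms in [x_k], and a rotation-invariant law on the sphere
does not charge hyperplanes.  The noise averages are sub-Gaussian, hence below the
threshold with probability 1 - delta; the thresholded matrix then has the rank of
[P D Q], and its pseudoinverse is bounded independently of [N], unless [gamma(N)]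
is bounded below, in which case the bound [1 / gamma] on the pseudoinverse is
enough. *)
Require Import Defs.
From HB Require Import structures.
From mathcomp Require Import all_boot all_order all_algebra.
From mathcomp Require Import complex.
From mathcomp Require Import all_classical all_reals all_analysis.
From mathcomp Require Import measurable_realfun.
From mathcomp Require Import ring lra zify.

Set Implicit Arguments.
Unset Strict Implicit.
Unset Printing Implicit Defensive.

Import Order.TTheory GRing.Theory Num.Theory.
Import numFieldNormedType.Exports.
Local Open Scope classical_set_scope.
Local Open Scope ring_scope.

Local Open Scope sesquilinear_scope.

(** * Frobenius norm *)

Section complex_modulus.
Variable R : realType.
Local Notation C := R[i].
Local Notation normc := (@Normc.normc R).
Implicit Types z w : C.

Lemma norm_normc z : `|z| = (normc z)%:C%C. Proof. by []. Qed.

Lemma normc_ge0 z : 0 <= normc z.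
Proof. by rewrite -lecR -norm_normc normr_ge0. Qed.

Lemma normcD_le z w : normc (z + w) <= normc z + normc w.
Proof. by rewrite -lecR rmorphD -!norm_normc ler_normD. Qed.

Lemma normc_opp z : normc (- z) = normc z.
Proof. by apply: complexI; rewrite -!norm_normc normrN. Qed.

Lemma normc_mul z w : normc (z * w) = normc z * normc w.
Proof. exact: Normc.normcM. Qed.

Lemma normc_inv z : normc z^-1 = (normc z)^-1.
Proof. exact: Normc.normcV. Qed.

Lemma normcX z n : normc (z ^+ n) = normc z ^+ n.
Proof. by apply: complexI; rewrite rmorphXn -!norm_normc normrX. Qed.

Lemma normc_real (x : R) : normc x%:C%C = `|x|.
Proof. by rewrite /Normc.normc /= expr0n addr0 sqrtr_sqr. Qed.

Lemma normc_conj z : normc z^* = normc z.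
Proof. by apply: complexI; rewrite -!norm_normc norm_conjC. Qed.

Lemma normc_eq0 z : (normc z == 0) = (z == 0).
Proof.
apply/eqP/eqP => [/Normc.eq0_normc //|->]; exact: Normc.normc0.
Qed.

Lemma normc_sum (I : Type) (r : seq I) (P : pred I) (F : I -> C) :
  normc (\sum_(i <- r | P i) F i) <= \sum_(i <- r | P i) normc (F i).
Proof.
elim/big_rec2: _ => [|i y x _ h]; first by rewrite Normc.normc0.
by apply: le_trans (normcD_le _ _) _; rewrite lerD2l.
Qed.

Lemma normc_sqr z : normc z ^+ 2 = complex.Re z ^+ 2 + complex.Im z ^+ 2.
Proof.
by case: z => a b; rewrite /Normc.normc sqr_sqrtr // addr_ge0 // sqr_ge0.
Qed.

End complex_modulus.

Lemma cauchy_schwarz_sum (R : realType) (I : finType) (x y : I -> R) :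
  (\sum_i x i * y i) ^+ 2 <= (\sum_i x i ^+ 2) * (\sum_i y i ^+ 2).
Proof.
have h : 0 <= \sum_i \sum_j (x i * y j - x j * y i) ^+ 2.
  by apply: sumr_ge0 => i _; apply: sumr_ge0 => j _; exact: sqr_ge0.
suff e : \sum_i \sum_j (x i * y j - x j * y i) ^+ 2 =
    2 * ((\sum_i x i ^+ 2) * (\sum_i y i ^+ 2) - (\sum_i x i * y i) ^+ 2).
  by move: h; rewrite e pmulr_rge0 // subr_ge0.
have e1 : \sum_i \sum_j (x i * y j - x j * y i) ^+ 2 =
   \sum_i \sum_j (x i ^+ 2 * y j ^+ 2) + \sum_i \sum_j (y i ^+ 2 * x j ^+ 2)
   - 2 * \sum_i \sum_j ((x i * y i) * (x j * y j)).
  rewrite mulr_sumr -!big_split -sumrB /=; apply: eq_bigr => i _.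
  rewrite mulr_sumr -!big_split -sumrB /=; apply: eq_bigr => j _.
  by ring.
rewrite e1 -!big_distrlr /=; ring.
Qed.

Section Frobenius.
Variable R : realType.
Local Notation C := R[i].
Local Notation normc := (@Normc.normc R).

Definition frob2 m n (A : 'M[C]_(m, n)) : R := \sum_i \sum_j normc (A i j) ^+ 2.
Definition frob m n (A : 'M[C]_(m, n)) : R := Num.sqrt (frob2 A).

Lemma frob2_ge0 m n (A : 'M[C]_(m, n)) : 0 <= frob2 A.
Proof. by apply: sumr_ge0 => i _; apply: sumr_ge0 => j _; exact: sqr_ge0. Qed.

Lemma frob_ge0 m n (A : 'M[C]_(m, n)) : 0 <= frob A.
Proof. exact: sqrtr_ge0. Qed.

Lemma frob_sqr m n (A : 'M[C]_(m, n)) : frob A ^+ 2 = frob2 A.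
Proof. by rewrite sqr_sqrtr // frob2_ge0. Qed.

Lemma frob_le m n (A : 'M[C]_(m, n)) x : 0 <= x -> frob2 A <= x ^+ 2 -> frob A <= x.
Proof. by move=> x0 h; rewrite -(ler_pXn2r (n := 2)) ?nnegrE ?frob_ge0 // frob_sqr. Qed.

Lemma frob2_pair m n (A : 'M[C]_(m, n)) :
  frob2 A = \sum_(p : 'I_m * 'I_n) normc (A p.1 p.2) ^+ 2.
Proof. by rewrite /frob2 pair_bigA. Qed.

Lemma frobD m n (A B : 'M[C]_(m, n)) : frob (A + B) <= frob A + frob B.
Proof.
apply: frob_le; first by rewrite addr_ge0 ?frob_ge0.
have h : \sum_(p : 'I_m * 'I_n) normc (A p.1 p.2) * normc (B p.1 p.2)
    <= frob A * frob B.
  apply: le_trans (ler_norm _) _; rewrite -(ler_pXn2r (n := 2)) ?nnegrE //; last first.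
    by rewrite mulr_ge0 ?frob_ge0.
  rewrite real_normK ?num_real // exprMn !frob_sqr !frob2_pair.
  exact: cauchy_schwarz_sum.
rewrite sqrrD !frob_sqr -addrA [_ *+ 2 + _]addrC addrA.
apply: (@le_trans _ _ (frob2 A + frob2 B + (\sum_(p : 'I_m * 'I_n)
   normc (A p.1 p.2) * normc (B p.1 p.2)) *+ 2)); last by rewrite lerD2l lerMn2r h orbT.
rewrite !frob2_pair -sumrMnl -!big_split /=; apply: ler_sum => p _.
rewrite mxE -addrA [_ ^+ 2 + _ *+ 2]addrC addrA -sqrrD.
by rewrite ler_pXn2r ?nnegrE ?addr_ge0 ?normc_ge0 ?normcD_le.
Qed.

Lemma frobM m n p (A : 'M[C]_(m, n)) (B : 'M[C]_(n, p)) :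
  frob (A *m B) <= frob A * frob B.
Proof.
apply: frob_le; first by rewrite mulr_ge0 ?frob_ge0.
rewrite exprMn !frob_sqr.
have -> : frob2 B = \sum_k \sum_j normc (B j k) ^+ 2 by rewrite /frob2 exchange_big.
rewrite /frob2 big_distrlr /=; apply: ler_sum => i _; apply: ler_sum => k _.
apply: le_trans (cauchy_schwarz_sum _ _).
rewrite ler_pXn2r ?nnegrE ?normc_ge0 //; last first.
  by apply: sumr_ge0 => j _; rewrite mulr_ge0 ?normc_ge0.
rewrite mxE; apply: le_trans (normc_sum _ _ _) _.
by apply: ler_sum => j _; rewrite normc_mul.
Qed.

Lemma frobN m n (A : 'M[C]_(m, n)) : frob (- A) = frob A.
Proof.
congr Num.sqrt; apply: eq_bigr => i _; apply: eq_bigr => j _.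
by rewrite mxE normc_opp.
Qed.

Lemma frobB m n (A B : 'M[C]_(m, n)) : frob (A - B) <= frob A + frob B.
Proof. by apply: le_trans (frobD _ _) _; rewrite frobN. Qed.

Lemma frob_eq0 m n (A : 'M[C]_(m, n)) : frob A = 0 -> A = 0.
Proof.
move=> h; have : frob2 A = 0 by rewrite -frob_sqr h expr0n.
rewrite frob2_pair => /eqP; rewrite psumr_eq0 => [|p _]; last exact: sqr_ge0.
move=> /allP h2; apply/matrixP => i j; rewrite mxE.
have := h2 (i, j); rewrite mem_index_enum => /(_ isT).
by rewrite /= sqrf_eq0 normc_eq0 => /eqP.
Qed.

Lemma frob_adj m n (A : 'M[C]_(m, n)) : frob (A ^t*) = frob A.
Proof.
congr Num.sqrt; rewrite /frob2 exchange_big; apply: eq_bigr => i _.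
by apply: eq_bigr => j _; rewrite !mxE normc_conj.
Qed.

Lemma mxtrace_frob2 m n (A : 'M[C]_(m, n)) : \tr (A *m A ^t*) = (frob2 A)%:C%C.
Proof.
rewrite /mxtrace /frob2 rmorph_sum; apply: eq_bigr => i _.
rewrite mxE rmorph_sum; apply: eq_bigr => j _.
by rewrite !mxE -normCK norm_normc rmorphXn.
Qed.

Lemma adj_mul m n p (A : 'M[C]_(m, n)) (B : 'M[C]_(n, p)) :
  (A *m B) ^t* = B ^t* *m A ^t*.
Proof. by rewrite trmx_mul map_mxM. Qed.

Lemma frob_mul_unitary m n (U : 'M[C]_n) (A : 'M[C]_(m, n)) :
  U \is unitarymx -> frob (A *m U) = frob A.
Proof.
move=> /unitarymxP hU; congr Num.sqrt; apply: complexI.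
by rewrite -!mxtrace_frob2 adj_mul mulmxA -[A *m U *m _]mulmxA hU mulmx1.
Qed.

Lemma frob_unitary_mul m n (U : 'M[C]_m) (A : 'M[C]_(m, n)) :
  U \is unitarymx -> frob (U *m A) = frob A.
Proof.
move=> hU; rewrite -frob_adj adj_mul frob_mul_unitary ?frob_adj //.
by rewrite trmxC_unitary.
Qed.

Lemma frob_svd n (U V : 'M[C]_n) (A : 'M[C]_n) :
  U \is unitarymx -> V \is unitarymx -> frob (U *m A *m V ^t*) = frob A.
Proof.
move=> hU hV; have hV' : V ^t* \is unitarymx by rewrite trmxC_unitary.
by rewrite (frob_mul_unitary _ hV') (frob_unitary_mul _ hU).
Qed.

Lemma frob_entry m n (A : 'M[C]_(m, n)) i j : normc (A i j) <= frob A.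
Proof.
rewrite -(ler_pXn2r (n := 2)) ?nnegrE ?normc_ge0 ?frob_ge0 // frob_sqr frob2_pair.
rewrite (bigD1 (i, j)) //= lerDl; apply: sumr_ge0 => p _; exact: sqr_ge0.
Qed.

Lemma frob_le_entries m n (A : 'M[C]_(m, n)) (x : R) : 0 <= x ->
  (forall i j, normc (A i j) <= x) -> frob A <= (m * n)%:R * x.
Proof.
move=> x0 h; case: (posnP (m * n)) => [mn0|mn0].
  apply: frob_le; first by rewrite mulr_ge0.
  rewrite mn0 mul0r expr0n frob2_pair big1 // => -[i j] _.
  by have := @enum_rank _ (i, j); rewrite card_prod !card_ord mn0 => -[].
apply: frob_le; first by rewrite mulr_ge0.
apply: (@le_trans _ _ ((m * n)%:R * x ^+ 2)).
  rewrite frob2_pair -[(m * n)%N](_ : #|{: 'I_m * 'I_n}| = _).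
    rewrite mulr_natl -sumr_const; apply: ler_sum => p _.
    by rewrite ler_pXn2r ?nnegrE ?normc_ge0.
  by rewrite card_prod !card_ord.
rewrite exprMn ler_wpM2r ?sqr_ge0 // expr2 ler_peMl ?ler0n //.
by rewrite ler1n.
Qed.

Lemma spectral_norm_frob m n (A : 'M[C]_(m, n)) :
  (0 < n)%N -> spectral_norm A <= frob A.
Proof.
have cv k (v : 'cV[C]_k) : cvnorm v = frob v.
  by congr Num.sqrt; apply: eq_bigr => i _; rewrite big_ord1.
move=> n0; apply: ge_sup.
  exists (cvnorm (A *m delta_mx (Ordinal n0) 0)); exists (delta_mx (Ordinal n0) 0) => //=.
  rewrite cv /frob -[RHS](sqrtr1); congr Num.sqrt; apply: complexI.
  rewrite -mxtrace_frob2 (_ : _ ^t* = delta_mx 0 (Ordinal n0)); last first.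
    apply/matrixP => i j; rewrite !mxE andbC.
    by case: (_ && _); rewrite ?conjC1 ?conjC0.
  by rewrite mxtrace_mulC mul_delta_mx /mxtrace big_ord1 mxE eqxx.
move=> _ [v /= hv <-]; rewrite cv; apply: le_trans (frobM _ _) _.
by rewrite -(cv _ v) hv mulr1.
Qed.

Lemma inj_mx_leq m n (A : 'M[C]_(m, n)) :
  (forall y : 'cV_n, A *m y = 0 -> y = 0) -> (n <= m)%N.
Proof.
move=> h; suff : row_free A^T by move/eqP <-; exact: rank_leq_col.
rewrite -kermx_eq0; apply/eqP/row_matrixP => i; rewrite row0.
apply: trmx_inj; rewrite trmx0; apply: h.
apply: trmx_inj; rewrite trmx_mul trmxK trmx0.
by rewrite -row_mul mulmx_ker row0.
Qed.

End Frobenius.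

(** * Singular values and the pseudoinverse *)

Section SVD.
Variable R : realType.
Local Notation C := R[i].
Local Notation normc := (@Normc.normc R).

Lemma row_adj_entry m n (A : 'M[C]_(m, n)) i j :
  (A *m A ^t*) i j = \sum_k A i k * (A j k)^*.
Proof. by rewrite mxE; apply: eq_bigr => k _; rewrite !mxE. Qed.

(* Orthonormal rows indexed by S, the others being zero, extend to a unitary
   matrix: replace the zero rows one at a time by unit vectors of the kernel. *)
Lemma unitary_completion n (k : nat) (S : {set 'I_n}) (W : 'M[C]_n) :
  #|~: S| = k -> W *m W ^t* = diag_mx (\row_i (i \in S)%:R) ->
  exists2 V : 'M[C]_n, V \is unitarymx &
    forall i, i \in S -> row i V = row i W.
Proof.
elim: k S W => [|k IH] S W cS hW.
  exists W => //; apply/unitarymxP; rewrite hW.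
  move/eqP: cS; rewrite cards_eq0 => /eqP cS.
  have -> : S = [set: 'I_n]%SET by rewrite -[S]finset.setCK cS finset.setC0.
  apply/matrixP => i j; rewrite !mxE.
  by rewrite finset.in_setT; case: eqP.
have [i0 i0S] : exists i0, i0 \in ~: S.
  by apply/set0Pn; rewrite -card_gt0 cS.
have i0S' : i0 \notin S by rewrite finset.in_setC in i0S.
have W0 : row i0 W = 0.
  apply: frob_eq0; rewrite /frob; apply/eqP; rewrite sqrtr_eq0 le_eqVlt; apply/orP; left.
  apply/eqP; apply: complexI; rewrite -mxtrace_frob2 /mxtrace big_ord1 row_adj_entry.
  have : (W *m W ^t*) i0 i0 = 0 by rewrite hW !mxE (negbTE i0S') mul0rn.
  rewrite row_adj_entry => e; rewrite rmorph0 -[RHS]e; apply: eq_bigr => j _.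
  by rewrite !mxE.
pose K := kermx (W ^t*).
have K0 : K != 0.
  apply/negP => /eqP /eqP; rewrite kermx_eq0 row_free_unit => hu.
  have : delta_mx 0 i0 *m W = 0 :> 'rV_n by rewrite -rowE.
  have hu' : W \in unitmx.
    by move: hu; rewrite map_unitmx unitmx_tr.
  move/(congr1 (fun M => M *m invmx W)); rewrite mulmxK // mul0mx.
  by move/matrixP/(_ 0 i0); rewrite !mxE !eqxx => /eqP; rewrite oner_eq0.
pose v0 := nz_row K.
have v0n : v0 != 0 by rewrite nz_row_eq0.
have v0W : v0 *m W ^t* = 0 by apply/sub_kermxP; exact: nz_row_sub.
have fv0 : frob v0 != 0 by apply: contra v0n => /eqP /frob_eq0 ->.
pose v := ((frob v0)^-1)%:C%C *: v0.
have vW : v *m W ^t* = 0 by rewrite -scalemxAl v0W scaler0.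
have vv : v *m v ^t* = 1.
  apply/matrixP => a b; rewrite !ord1.
  have -> : (v *m v ^t*) 0 0 = \tr (v *m v ^t*) by rewrite /mxtrace big_ord1.
  rewrite mxtrace_frob2 mxE eqxx /frob2 big_ord1.
  have -> : \sum_j normc (v 0 j) ^+ 2 = (frob v0)^-1 ^+ 2 * frob2 v0.
    rewrite /frob2 big_ord1 mulr_sumr; apply: eq_bigr => j _.
    by rewrite mxE normc_mul normc_real ger0_norm ?invr_ge0 ?frob_ge0 // exprMn.
  by rewrite -frob_sqr -exprMn mulVf // expr1n.
pose W' : 'M[C]_n := \matrix_(i, j) if i == i0 then v 0 j else W i j.
have W'i0 j : W' i0 j = v 0 j by rewrite mxE eqxx.
have W'i i j : i != i0 -> W' i j = W i j by rewrite mxE => /negbTE ->.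
have hvv : \sum_j v 0 j * (v 0 j)^* = 1.
  by rewrite -row_adj_entry vv mxE eqxx.
have hvi i : \sum_j v 0 j * (W i j)^* = 0.
  have : (v *m W ^t*) 0 i = 0 by rewrite vW mxE.
  by rewrite mxE => e; rewrite -[RHS]e; apply: eq_bigr => j _; rewrite !mxE.
have [||V Vu hV] := IH (i0 |: S) W'.
- have : ~: S = i0 |: ~: (i0 |: S).
    rewrite finset.setCU; apply/setP => j; rewrite !inE.
    by case: eqP => [->|] //=.
  by move=> e; move: cS; rewrite e cardsU1 !inE eqxx /= add1n => -[].
- apply/matrixP => i j; rewrite row_adj_entry !mxE in_setU1.
  case: (eqVneq i i0) => [->|ii0]; case: (eqVneq j i0) => [->|ji0].
  + rewrite mulr1n -[RHS]hvv.
    by apply: eq_bigr => k' _; rewrite W'i0.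
  + rewrite mulr0n -[RHS](hvi j).
    by apply: eq_bigr => k' _; rewrite W'i0 W'i.
  + have : (\sum_j v 0 j * (W i j)^*)^* = 0 by rewrite hvi conjC0.
    rewrite rmorph_sum (negbTE ii0) /= ?mulr0n => e; rewrite -[RHS]e.
    by apply: eq_bigr => k' _; rewrite W'i0 W'i // rmorphM /= conjCK mulrC.
  + have := congr1 (fun M : 'M[C]_n => M i j) hW; rewrite row_adj_entry !mxE /= => <-.
    by apply: eq_bigr => k' _; rewrite !W'i.
exists V => // i iS; rewrite hV ?in_setU1 ?iS ?orbT //.
apply/rowP => j; rewrite !mxE; case: eqP => // e.
by move: i0S'; rewrite -e iS.
Qed.

Lemma orthogonal_rows_factor n (B : 'M[C]_n) :
  (forall i j, i != j -> (B *m B ^t*) i j = 0) ->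
  exists (s : 'I_n -> R) (V : 'M[C]_n),
    [/\ V \is unitarymx, (forall i, 0 <= s i) & B = diag_real s *m V].
Proof.
move=> hB; pose s i := frob (row i B).
pose W : 'M[C]_n := \matrix_(i, j) (((s i)^-1)%:C%C * B i j).
pose S := [set i | s i != 0]%SET.
have hs i : (s i ^+ 2)%:C%C = (B *m B ^t*) i i.
  rewrite frob_sqr -mxtrace_frob2 /mxtrace big_ord1 !row_adj_entry.
  by apply: eq_bigr => k _; rewrite !mxE.
have hW : W *m W ^t* = diag_mx (\row_i (i \in S)%:R).
  apply/matrixP => i j.
  have -> : (W *m W ^t*) i j = ((s i)^-1 * (s j)^-1)%:C%C * (B *m B ^t*) i j.
    rewrite !row_adj_entry mulr_sumr; apply: eq_bigr => k _.
    rewrite !mxE rmorphM /= rmorphM /=.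
    rewrite [X in _ * (X * _) = _](_ : _ = ((s j)^-1)%:C%C); last first.
      by apply: CrealP; rewrite complex_real.
    by rewrite mulrACA.
  case: (eqVneq i j) => [<-|ij]; last by rewrite hB // mulr0 mxE (negbTE ij) mulr0n.
  rewrite -hs -rmorphM /= -expr2 -exprMn !mxE eqxx mulr1n finset.inE.
  by case: eqP => [->|/eqP si]; [rewrite mulr0 expr0n|rewrite mulVf // expr1n].
have [V Vu hV] := unitary_completion erefl hW.
exists s, V; split => //; first by move=> i; exact: frob_ge0.
rewrite /diag_real mul_diag_mx; apply/matrixP => i j; rewrite !mxE.
case: (eqVneq (s i) 0) => [si|si].
  rewrite si mul0r; have /frob_eq0 /rowP /(_ j) := si.
  by rewrite !mxE.
have := hV i; rewrite finset.inE => /(_ si) /rowP /(_ j); rewrite !mxE => ->.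
by rewrite mulrA -rmorphM /= mulfV // mul1r.
Qed.

Lemma unitary_adj_mul n (U : 'M[C]_n) : U \is unitarymx -> U ^t* *m U = 1%:M.
Proof. by rewrite -trmxC_unitary => /unitarymxP; rewrite trmxCK. Qed.

Lemma svd_exists n (A : 'M[C]_n) :
  exists (U : 'M[C]_n) (s : 'I_n -> R) (V : 'M[C]_n), is_svd A U s V.
Proof.
pose H := A *m A ^t*.
have Hn : H \is normalmx.
  by apply/normalmxP; rewrite /H adj_mul trmxCK.
have Pu := spectral_unitarymx H.
move/orthomx_spectralP: (Hn); rewrite invmx_unitary // => hH.
set P := spectralmx H in Pu hH.
have [|s [V [Vu s0 hB]]] := @orthogonal_rows_factor n (P *m A).
  move=> i j ij; rewrite adj_mul mulmxA -(mulmxA P A) -/H hH.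
  rewrite -!mulmxA (unitarymxP Pu) mulmx1 mulmxA (unitarymxP Pu) mul1mx.
  by rewrite mxE (negbTE ij) mulr0n.
exists (P ^t*), s, (V ^t*); split; [by rewrite trmxC_unitary|by rewrite trmxC_unitary|exact: s0|].
by rewrite trmxCK -mulmxA -hB mulmxA (unitary_adj_mul Pu) mul1mx.
Qed.

Lemma penrose_uniq m n (A : 'M[C]_(m, n)) (X Y : 'M[C]_(n, m)) :
  penrose A X -> penrose A Y -> X = Y.
Proof.
move=> [x1 x2 x3 x4] [y1 y2 y3 y4].
have eX : X = X *m A *m Y.
  have e : A *m X = A *m Y.
    by rewrite -x3 -y3 -[in LHS]y1 -!mulmxA mulmxA adj_mul x3 y3 !mulmxA x1.
  by rewrite -[LHS]x2 -mulmxA e mulmxA.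
have eY : Y = X *m A *m Y.
  have e : Y *m A = X *m A.
    by rewrite -x4 -y4 -[in LHS]x1 !mulmxA -[Y *m _ *m _ *m _]mulmxA adj_mul x4 y4 !mulmxA
      -[X *m A *m Y *m A]mulmxA -(mulmxA X) (mulmxA A) y1.
  by rewrite -[LHS]y2 e.
by rewrite eX -eY.
Qed.

Lemma pinvE m n (A : 'M[C]_(m, n)) (X : 'M[C]_(n, m)) : penrose A X -> Defs.pinv A = X.
Proof.
move=> h; rewrite /Defs.pinv; case: xgetP => [Y _ hY|/(_ X)]; last by case/(_ h).
exact: penrose_uniq hY h.
Qed.

Lemma diag_realM n (s t : 'I_n -> R) :
  diag_real s *m diag_real t = diag_real (fun i => s i * t i).
Proof.
rewrite /diag_real mulmx_diag; congr diag_mx.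
by apply/rowP => i; rewrite !mxE rmorphM.
Qed.

Lemma diag_real_adj n (s : 'I_n -> R) : (diag_real s) ^t* = diag_real s.
Proof.
apply/matrixP => i j; rewrite !mxE eq_sym; case: eqP => [->|_]; last by rewrite !mulr0n conjC0.
by rewrite !mulr1n; apply/CrealP; rewrite complex_real.
Qed.

Lemma frob_diag_le n (s : 'I_n -> R) (x : R) : 0 <= x ->
  (forall i, `|s i| <= x) -> frob (diag_real s) <= (n * n)%:R * x.
Proof.
move=> x0 h; apply: frob_le_entries => // i j; rewrite !mxE.
case: eqP => _; first by rewrite mulr1n normc_real; exact: h.
by rewrite mulr0n Normc.normc0.
Qed.

Lemma pinv_svd n (U V : 'M[C]_n) (s : 'I_n -> R) :
  U \is unitarymx -> V \is unitarymx ->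
  Defs.pinv (U *m diag_real s *m V ^t*) = V *m diag_real (fun i => (s i)^-1) *m U ^t*.
Proof.
move=> Uu Vu; have U1 := unitary_adj_mul Uu; have V1 := unitary_adj_mul Vu.
have e1 : (U *m diag_real s *m V ^t*) *m (V *m diag_real (fun i => (s i)^-1) *m U ^t*)
    = U *m diag_real (fun i => s i * (s i)^-1) *m U ^t*.
  by rewrite -diag_realM !mulmxA -[U *m _ *m _ *m V]mulmxA V1 mulmx1.
have e2 : (V *m diag_real (fun i => (s i)^-1) *m U ^t*) *m (U *m diag_real s *m V ^t*)
    = V *m diag_real (fun i => (s i)^-1 * s i) *m V ^t*.
  by rewrite -diag_realM !mulmxA -[V *m _ *m _ *m U]mulmxA U1 mulmx1.
apply: pinvE; split.
- rewrite e1 !mulmxA -[U *m _ *m _ *m U]mulmxA U1 mulmx1 -(mulmxA U) diag_realM.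
  congr (_ *m diag_real _ *m _); apply/funext => i.
  by case: (eqVneq (s i) 0) => [->|si]; rewrite ?mulr0 // divff // mul1r.
- rewrite e2 !mulmxA -[V *m _ *m _ *m V]mulmxA V1 mulmx1 -(mulmxA V) diag_realM.
  congr (_ *m diag_real _ *m _); apply/funext => i.
  by case: (eqVneq (s i) 0) => [->|si]; rewrite ?invr0 ?mulr0 // mulVf // mul1r.
- by rewrite e1 !adj_mul diag_real_adj trmxCK mulmxA.
- by rewrite e2 !adj_mul diag_real_adj trmxCK mulmxA.
Qed.

Lemma low_rank_svd n (g : R) (A : 'M[C]_n) :
  exists U s V, is_svd A U s V /\ low_rank_approx g A =
    U *m diag_real (fun i => if g <= s i then s i else 0) *m V ^t*.
Proof.
rewrite /low_rank_approx; case: xgetP => [B _ [U [s [V [h1 h2]]]]|].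
  by exists U, s, V.
have [U [s [V h]]] := svd_exists A.
by move=> /(_ (U *m diag_real (fun i => if g <= s i then s i else 0) *m V ^t*)) []; exists U, s, V.
Qed.

End SVD.

(** * Perturbation of the truncated pseudoinverse *)

Section perturbation.
Variable R : realType.
Local Notation C := R[i].
Local Notation normc := (@Normc.normc R).

Lemma diag_real_mulE n p (s : 'I_n -> R) (x : 'M[C]_(n, p)) i j :
  (diag_real s *m x) i j = (s i)%:C%C * x i j.
Proof. by rewrite /diag_real mul_diag_mx !mxE. Qed.

Lemma frob_diag_ge n (s : 'I_n -> R) (x : 'cV[C]_n) (a : R) : 0 <= a ->
  (forall i, x i 0 != 0 -> a <= s i) -> a * frob x <= frob (diag_real s *m x).
Proof.
move=> a0 h; rewrite -(ler_pXn2r (n := 2)) ?nnegrE ?mulr_ge0 ?frob_ge0 //.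
rewrite exprMn !frob_sqr mulr_sumr; apply: ler_sum => i _; rewrite !big_ord1.
rewrite diag_real_mulE normc_mul normc_real exprMn.
case: (eqVneq (x i 0) 0) => [->|xi]; first by rewrite Normc.normc0 expr0n !mulr0.
have si := h _ xi; have s0 := le_trans a0 si.
by rewrite ler_wpM2r ?sqr_ge0 // ger0_norm // ler_pXn2r.
Qed.

Lemma frob_diag_le_vec n (s : 'I_n -> R) (x : 'cV[C]_n) (a : R) : 0 <= a ->
  (forall i, 0 <= s i) ->
  (forall i, x i 0 != 0 -> s i <= a) -> frob (diag_real s *m x) <= a * frob x.
Proof.
move=> a0 s0 h; rewrite -(ler_pXn2r (n := 2)) ?nnegrE ?mulr_ge0 ?frob_ge0 //.
rewrite exprMn !frob_sqr mulr_sumr; apply: ler_sum => i _; rewrite !big_ord1.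
rewrite diag_real_mulE normc_mul normc_real exprMn.
case: (eqVneq (x i 0) 0) => [->|xi]; first by rewrite Normc.normc0 expr0n !mulr0.
by rewrite ler_wpM2r ?sqr_ge0 // ger0_norm // ler_pXn2r ?nnegrE // h.
Qed.

Lemma gram_unit m r (P : 'M[C]_(m, r)) :
  (forall y : 'cV_r, P *m y = 0 -> y = 0) -> P ^t* *m P \in unitmx.
Proof.
move=> h; rewrite -unitmx_tr -row_free_unit -kermx_eq0; apply/eqP/row_matrixP => i.
rewrite row0; set k := row i _.
have hk : (P ^t* *m P) *m k^T = 0.
  by apply: trmx_inj; rewrite trmx_mul trmxK /k -row_mul mulmx_ker row0 trmx0.
apply: trmx_inj; rewrite trmx0; apply: h; apply: frob_eq0; apply/eqP.
rewrite sqrtr_eq0 le_eqVlt; apply/orP; left; apply/eqP; apply: complexI.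
by rewrite -mxtrace_frob2 mxtrace_mulC adj_mul -mulmxA (mulmxA _ P) hk mulmx0 mxtrace0 rmorph0.
Qed.

(* The singular vectors of singular value at least g inject into the row space
   of Q since |E0| < g, so there are at most r of them; those of singular value
   at least s / 2 are at least r. *)
Lemma singular_value_gap n r (F : 'M[C]_(n, r)) (Q : 'M[C]_(r, n))
    (Qp : 'M[C]_(n, r)) (E0 U V : 'M[C]_n) (sg : 'I_n -> R) (s g : R) :
  Q *m Qp = 1%:M ->
  (forall y : 'cV_r, s * frob (Qp *m y) <= frob (F *m Q *m (Qp *m y))) ->
  0 < s -> frob E0 < g -> g <= s / 2 -> is_svd (F *m Q + E0) U sg V ->
  forall i, g <= sg i -> s / 2 <= sg i.
Proof.
move=> hQ hs s0 hE gs [Uu Vu sg0 hA].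
have g0 : 0 < g by exact: le_lt_trans (frob_ge0 _) hE.
have V1 := unitary_adj_mul Vu.
pose S := [set i | g <= sg i]%SET; pose S' := [set i | s / 2 <= sg i]%SET.
have cS : (#|S| <= r)%N.
  pose J : 'M[C]_(n, #|S|) := \matrix_(i, j) (i == enum_val j)%:R.
  apply: (@inj_mx_leq _ _ _ (Q *m V *m J)) => y hy.
  have hJ (j : 'I_#|S|) : (J *m y) (enum_val j) 0 = y j 0.
    rewrite mxE (bigD1 j) //= mxE eqxx mul1r big1 ?addr0 // => k kj.
    by rewrite mxE (inj_eq enum_val_inj) eq_sym (negbTE kj) mul0r.
  have hJ0 i : i \notin S -> (J *m y) i 0 = 0.
    move=> iS; rewrite mxE big1 // => k _; rewrite mxE.
    case: eqP => [e|]; last by rewrite mul0r.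
    by move: iS; rewrite e enum_valP.
  have [x hx] : exists x, x = J *m y by exists (J *m y).
  rewrite -hx in hJ hJ0.
  suff x0 : x = 0 by apply/colP => j; rewrite -hJ x0 !mxE.
  have e1 : (F *m Q + E0) *m (V *m x) = E0 *m (V *m x).
    rewrite mulmxDl -mulmxA (_ : Q *m (V *m x) = 0) ?mulmx0 ?add0r //.
    by rewrite -hy hx !mulmxA.
  have e2 : frob ((F *m Q + E0) *m (V *m x)) = frob (diag_real sg *m x).
    rewrite hA !mulmxA -[U *m _ *m _ *m V]mulmxA V1 mulmx1 -mulmxA.
    exact: frob_unitary_mul.
  have h1 : g * frob x <= frob E0 * frob x.
    apply: (@le_trans _ _ (frob (diag_real sg *m x))).
      apply: frob_diag_ge; first exact: ltW.
      move=> i xi; have : i \in S by apply: contraNT xi => /hJ0 ->.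
      by rewrite finset.inE.
    by rewrite -e2 e1; apply: le_trans (frobM _ _) _; rewrite frob_unitary_mul.
  apply: frob_eq0; apply/eqP; rewrite eq_le frob_ge0 andbT leNgt; apply/negP => x0.
  by move: h1; rewrite ler_pM2r // leNgt hE.
have cS' : (r <= #|S'|)%N.
  pose J : 'M[C]_(#|S'|, r) := \matrix_(i, j) (V ^t* *m Qp) (enum_val i) j.
  apply: (@inj_mx_leq _ _ _ J) => y hy.
  pose x := V ^t* *m (Qp *m y).
  have hx i : i \in S' -> x i 0 = 0.
    move=> iS; have := congr1 (fun M : 'cV[C]_(#|S'|) => M (enum_rank_in iS i) 0) hy.
    rewrite [RHS]mxE => e; rewrite /x mulmxA mxE -[RHS]e mxE; apply: eq_bigr => k _.
    by rewrite [J _ _]mxE enum_rankK_in.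
  have Vu' : V ^t* \is unitarymx by rewrite trmxC_unitary.
  have fx : frob x = frob (Qp *m y) := frob_unitary_mul _ Vu'.
  have h1 : frob ((F *m Q + E0) *m (Qp *m y)) <= s / 2 * frob x.
    rewrite hA -!mulmxA (frob_unitary_mul _ Uu) -/x; apply: frob_diag_le_vec => //.
      by rewrite divr_ge0 // ltW.
    move=> i xi; have : i \notin S' by apply: contraNN xi => /hx ->.
    by rewrite finset.inE -ltNge => /ltW.
  have h2 : s * frob x <= s / 2 * frob x + frob E0 * frob x.
    rewrite {1}fx; apply: le_trans (hs y) _.
    have -> : F *m Q *m (Qp *m y) = (F *m Q + E0) *m (Qp *m y) - E0 *m (Qp *m y).
      by rewrite mulmxDl addrK.
    apply: le_trans (frobB _ _) _; apply: lerD => //.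
    by rewrite fx; exact: frobM.
  have x0 : frob x = 0.
    apply/eqP; rewrite eq_le frob_ge0 andbT leNgt; apply/negP => x0.
    move: h2; rewrite -mulrDl ler_pM2r // => h2.
    move: (lt_le_trans hE gs) h2; clear; move: (frob E0) => e; lra.
  have /frob_eq0 q0 : frob (Qp *m y) = 0 by rewrite -fx.
  by rewrite -[y]mul1mx -hQ -mulmxA q0 mulmx0.
have sub : S' \subset S.
  by apply/fintype.subsetP => i; rewrite !finset.inE => /(le_trans gs).
have eS : S' = S.
  by apply/eqP; rewrite eqEcard sub (leq_trans cS).
move=> i gi; have : i \in S by rewrite finset.inE.
by rewrite -eS finset.inE.
Qed.

Definition pleft m r (P : 'M[C]_(m, r)) : 'M[C]_(r, m) :=
  invmx (P ^t* *m P) *m P ^t*.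

Lemma pleftK m r (P : 'M[C]_(m, r)) :
  (forall y : 'cV_r, P *m y = 0 -> y = 0) -> pleft P *m P = 1%:M.
Proof. by move=> h; rewrite /pleft -mulmxA mulVmx // gram_unit. Qed.

Lemma invr_bound (x a : R) : 0 < a -> (x != 0 -> a <= x) -> `|x^-1| <= a^-1.
Proof.
move=> a0 h; case: (eqVneq x 0) => [->|x0].
  by rewrite invr0 normr0 invr_ge0 ltW.
have ax := h x0; have xp := lt_le_trans a0 ax.
by rewrite ger0_norm ?invr_ge0 ?(ltW xp) // lef_pV2.
Qed.

Lemma perturbation_large n (A0 A1 T : 'M[C]_n) (g g0 w : R) :
  0 < g0 -> g0 <= g -> 0 <= w -> frob A1 <= w + g ->
  frob (T - A1 *m Defs.pinv (low_rank_approx g A0)) <=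
    (frob T / g0 + w * (n * n)%:R / g0 ^+ 2 + (n * n)%:R / g0) * g.
Proof.
move=> g00 g0g w0 hA1; have gp : 0 < g := lt_le_trans g00 g0g.
have [U [s [V [[Uu Vu s0 hA] ->]]]] := low_rank_svd g A0.
rewrite pinv_svd //; set X := _ *m U ^t*.
have hX : frob X <= (n * n)%:R * g^-1.
  rewrite /X (frob_svd _ Vu Uu).
  apply: frob_diag_le; first by rewrite invr_ge0 ltW.
  by move=> i; apply: invr_bound => //; case: ifP => // _; rewrite eqxx.
apply: le_trans (frobB _ _) _; set k := (n * n)%:R in hX *.
have k0 : 0 <= k by exact: ler0n.
have gg0 : 1 <= g / g0 by rewrite ler_pdivlMr // mul1r.
have h1 : frob T <= frob T / g0 * g.
  by rewrite -mulrA [g0^-1 * g]mulrC ler_peMr ?frob_ge0.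
have h2 : frob (A1 *m X) <= (w * k / g0 ^+ 2 + k / g0) * g.
  apply: le_trans (frobM _ _) _.
  apply: (@le_trans _ _ ((w + g) * (k * g^-1))).
    by apply: ler_pM => //; exact: frob_ge0.
  have -> : (w + g) * (k * g^-1) = w * k * g^-1 + k by field; rewrite gt_eqF.
  rewrite mulrDl; apply: lerD.
    rewrite -!mulrA; apply: ler_wpM2l => //; apply: ler_wpM2l => //.
    rewrite -[leLHS]mul1r -[X in X / g <= _](mulr1 1) -[1 * 1](expr2 1).
    have -> : (g0 ^+ 2)^-1 * g = (g / g0) ^+ 2 / g by field; rewrite !gt_eqF.
    by rewrite ler_pM2r ?invr_gt0 // ler_pXn2r ?nnegrE //; exact: le_trans gg0.
  by rewrite -mulrA [g0^-1 * g]mulrC ler_peMr.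
by rewrite -addrA mulrDl; apply: lerD.
Qed.

Lemma perturbation_small n r (P : 'M[C]_(n, r)) (Q : 'M[C]_(r, n))
    (Qp : 'M[C]_(n, r)) (Lam D D' : 'M[C]_r) (E0 E1 : 'M[C]_n) (s g kD : R) :
  (forall y : 'cV_r, P *m y = 0 -> y = 0) -> Q *m Qp = 1%:M -> D *m D' = 1%:M ->
  frob D' <= kD ->
  (forall y : 'cV_r, s * frob (Qp *m y) <= frob (P *m D *m Q *m (Qp *m y))) ->
  0 < s -> frob E0 < g -> frob E1 <= g -> g <= s / 2 ->
  frob (P *m Lam *m pleft P - (P *m Lam *m D *m Q + E1) *m
      Defs.pinv (low_rank_approx g (P *m D *m Q + E0))) <=
    (frob (P *m Lam *m invmx (P ^t* *m P)) *
       ((frob (1%:M : 'M[C]_n) + (n * n)%:R) * ((n * n)%:R + 1) * (frob Qp * kD))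
      + (frob (P *m Lam *m pleft P) + 1) * ((n * n)%:R * (2 / s))) * g.
Proof.
move=> hP hQ hD hkD hs s0 hE0 hE1 gs; set T := P *m Lam *m pleft P.
have gp : 0 < g by exact: le_lt_trans (frob_ge0 _) hE0.
set A0 := P *m D *m Q + E0.
have [U [sg [V [hsvd ->]]]] := low_rank_svd g A0.
have gap := singular_value_gap hQ hs s0 hE0 gs hsvd.
case: hsvd => Uu Vu sg0 hA; rewrite pinv_svd //.
pose t i := if g <= sg i then sg i else 0; rewrite -/t.
set X := _ *m U ^t*; set B := U *m diag_real t *m V ^t*.
have U1 := unitary_adj_mul Uu; have V1 := unitary_adj_mul Vu.
set k := (n * n)%:R; have k0 : 0 <= k by exact: ler0n.
have hX : frob X <= k * (2 / s).
  rewrite /X (frob_svd _ Vu Uu).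
  rewrite -[2 / s]invf_div.
  apply: frob_diag_le; first by rewrite invr_ge0 divr_ge0 // ltW.
  move=> i; apply: invr_bound; first by rewrite divr_gt0.
  by rewrite /t; case: ifP => [/gap //|_]; rewrite eqxx.
have hAB : A0 - B = U *m diag_real (fun i => sg i - t i) *m V ^t*.
  rewrite hA /B -mulmxBl -mulmxBr; congr (_ *m _ *m _).
  apply/matrixP => i j; rewrite !mxE; case: eqP => _; rewrite ?mulr1n ?mulr0n ?subr0 //.
  by rewrite rmorphB.
have hBX : B *m X = U *m diag_real (fun i => t i * (t i)^-1) *m U ^t*.
  by rewrite /B /X -diag_realM !mulmxA -[U *m _ *m _ *m V]mulmxA V1 mulmx1.
have hABX : (A0 - B) *m X = 0.
  rewrite hAB /X !mulmxA -[U *m _ *m _ *m V]mulmxA V1 mulmx1 -(mulmxA U) diag_realM.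
  rewrite (_ : diag_real _ = 0) ?mulmx0 ?mul0mx //; apply/matrixP => i j; rewrite !mxE.
  case: eqP => _; rewrite ?mulr1n ?mulr0n //.
  by rewrite /t; case: ifP; rewrite ?subrr ?invr0 ?mul0r ?mulr0.
have hBXB : B *m X *m B = B.
  rewrite hBX /B !mulmxA -[U *m _ *m _ *m U]mulmxA U1 mulmx1 -(mulmxA U) diag_realM.
  congr (_ *m diag_real _ *m _); apply/funext => i.
  by case: (eqVneq (t i) 0) => [->|ti]; rewrite ?mulr0 // divff // mul1r.
have hherm : (1%:M - B *m X) ^t* = 1%:M - B *m X.
  rewrite linearB /= map_mxB trmx1 map_mx1 hBX !adj_mul diag_real_adj trmxCK.
  by rewrite mulmxA.
have fAB : frob (A0 - B) <= k * g.
  rewrite hAB (frob_svd _ Uu Vu).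
  apply: frob_diag_le; first exact: ltW.
  move=> i; rewrite /t; case: ifPn => [_|]; first by rewrite subrr normr0 ltW.
  by rewrite -ltNge subr0 ger0_norm // => /ltW.
have f1BX : frob (1%:M - B *m X) <= frob (1%:M : 'M[C]_n) + k.
  apply: le_trans (frobB _ _) _; apply: lerD => //.
  rewrite hBX (frob_svd _ Uu Uu) -[k]mulr1.
  apply: frob_diag_le => // i.
  by case: (eqVneq (t i) 0) => [->|ti]; rewrite ?mul0r ?normr0 // divff // normr1.
have hPB : (1%:M - B *m X) *m P = (1%:M - B *m X) *m (A0 - B - E0) *m (Qp *m D').
  have -> : (1%:M - B *m X) *m (A0 - B - E0) = (1%:M - B *m X) *m (P *m D *m Q).
    have -> : A0 - B - E0 = P *m D *m Q - B by rewrite /A0; apply/matrixP => i j;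
      rewrite !mxE; ring.
    have e0 : (1%:M - B *m X) *m B = 0 by rewrite mulmxBl mul1mx hBXB subrr.
    by rewrite mulmxBr e0 subr0.
  rewrite -!mulmxA; congr (_ *m (_)); rewrite (mulmxA Q) hQ mul1mx hD.
  by rewrite mulmx1.
have hT1 : T *m (1%:M - B *m X) =
    P *m Lam *m invmx (P ^t* *m P) *m ((1%:M - B *m X) *m P) ^t*.
  by rewrite adj_mul hherm /T /pleft !mulmxA.
have hTG : P *m Lam *m D *m Q = T *m (P *m D *m Q).
  have hTP : T *m P = P *m Lam by rewrite /T -(mulmxA (P *m Lam)) (pleftK hP) mulmx1.
  by rewrite (mulmxA T) (mulmxA T) hTP.
have -> : T - (P *m Lam *m D *m Q + E1) *m X =
    T *m (1%:M - B *m X) + (T *m E0 *m X - E1 *m X).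
  have e : T *m (P *m D *m Q) *m X = T *m (B *m X) - T *m E0 *m X.
    have -> : P *m D *m Q = (A0 - B) + B - E0.
      by rewrite /A0; apply/matrixP => i j; rewrite !mxE; ring.
    by rewrite -(mulmxA T) mulmxBl mulmxDl hABX add0r mulmxBr -!mulmxA.
  rewrite hTG mulmxDl e mulmxBr mulmx1.
  move: (T *m (B *m X)) (T *m E0 *m X) (E1 *m X) => a b c.
  by rewrite opprD opprB [b - a]addrC -!addrA.
apply: le_trans (frobD _ _) _; rewrite [leRHS]mulrDl; apply: lerD.
  rewrite hT1 -mulrA; apply: le_trans (frobM _ _) _; apply: ler_wpM2l; first exact: frob_ge0.
  rewrite frob_adj hPB; apply: le_trans (frobM _ _) _.
  have fQD : frob (Qp *m D') <= frob Qp * kD.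
    by apply: le_trans (frobM _ _) _; rewrite ler_wpM2l // frob_ge0.
  have fE : frob (A0 - B - E0) <= (k + 1) * g.
    by apply: le_trans (frobB _ _) _; rewrite mulrDl mul1r lerD // ltW.
  have -> : (frob (1%:M : 'M[C]_n) + k) * (k + 1) * (frob Qp * kD) * g =
    (frob (1%:M : 'M[C]_n) + k) * ((k + 1) * g) * (frob Qp * kD) by ring.
  apply: ler_pM => //; rewrite ?frob_ge0 //; apply: le_trans (frobM _ _) _.
  by apply: ler_pM => //; rewrite ?frob_ge0.
apply: le_trans (frobB _ _) _; rewrite -mulrA mulrDl mul1r; apply: lerD.
  rewrite -mulmxA; apply: le_trans (frobM _ _) _; apply: ler_wpM2l; first exact: frob_ge0.
  rewrite [leRHS]mulrC; apply: le_trans (frobM _ _) _.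
  by apply: ler_pM; rewrite ?frob_ge0 // ltW.
rewrite [leRHS]mulrC; apply: le_trans (frobM _ _) _.
by apply: ler_pM; rewrite ?frob_ge0.
Qed.

End perturbation.

Section perturbation_bound.
Variable R : realType.
Local Notation C := R[i].

Lemma frob_mul3 m n p q (A : 'M[C]_(m, n)) (B : 'M[C]_(n, p)) (D : 'M[C]_(p, q))
    (k : R) : frob B <= k -> frob (A *m B *m D) <= frob A * k * frob D.
Proof.
move=> h; apply: le_trans (frobM _ _) _; rewrite ler_wpM2r ?frob_ge0 //.
by apply: le_trans (frobM _ _) _; rewrite ler_wpM2l ?frob_ge0.
Qed.

Lemma perturbation_bound n r (P : 'M[C]_(n, r)) (Q : 'M[C]_(r, n))
    (Qp : 'M[C]_(n, r)) (Lam : 'M[C]_r) (kD K : R) :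
  (forall y : 'cV_r, P *m y = 0 -> y = 0) -> Q *m Qp = 1%:M ->
  0 <= kD -> 0 <= K ->
  exists2 c : R, 0 < c & forall (N : nat) (g : R) (D D' : 'M[C]_r) (E0 E1 : 'M[C]_n),
    (0 < N)%N -> D *m D' = 1%:M -> frob D <= kD -> frob D' <= kD ->
    1 <= g * Num.sqrt N%:R ->
    frob E0 <= g - (2 * Num.sqrt N%:R)^-1 + K / N%:R ->
    frob E1 <= g - (2 * Num.sqrt N%:R)^-1 + K / N%:R ->
    frob (P *m Lam *m pleft P - (P *m Lam *m D *m Q + E1) *m
      Defs.pinv (low_rank_approx g (P *m D *m Q + E0))) <= c * g.
Proof.
move=> hP hQ kD0 K0; set T := P *m Lam *m pleft P.
pose s := (frob Qp * kD * frob (pleft P) + 1)^-1.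
have s'0 : 0 < frob Qp * kD * frob (pleft P) + 1.
  by rewrite ltr_wpDl // !mulr_ge0 ?frob_ge0.
have s0 : 0 < s by rewrite invr_gt0.
pose g0 := Num.min (s / 2) (2 * K + 1)^-1.
have K1 : 0 < 2 * K + 1 by rewrite ltr_wpDl // mulr_ge0.
have g00 : 0 < g0 by rewrite lt_min divr_gt0 // invr_gt0.
pose w := frob (P *m Lam) * kD * frob Q + K.
have w0 : 0 <= w by rewrite addr_ge0 // !mulr_ge0 ?frob_ge0.
pose c1 := frob T / g0 + w * (n * n)%:R / g0 ^+ 2 + (n * n)%:R / g0.
pose c2 := (frob (P *m Lam *m invmx (P ^t* *m P)) *
       ((frob (1%:M : 'M[C]_n) + (n * n)%:R) * ((n * n)%:R + 1) * (frob Qp * kD))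
      + (frob T + 1) * ((n * n)%:R * (2 / s))).
have c10 : 0 <= c1.
  by rewrite !addr_ge0 // ?divr_ge0 ?mulr_ge0 ?frob_ge0 ?ler0n ?sqr_ge0 // ltW.
have c20 : 0 <= c2.
  by rewrite addr_ge0 // !(mulr_ge0, addr_ge0, frob_ge0, ler0n, invr_ge0) // ltW.
exists (c1 + c2 + 1); first by rewrite ltr_wpDl // addr_ge0.
move=> N g D D' E0 E1 N0 hD fD fD' hg hE0 hE1.
have sN0 : 0 < Num.sqrt (N%:R : R) by rewrite sqrtr_gt0 ltr0n.
have NE : (N%:R : R) = Num.sqrt N%:R ^+ 2 by rewrite sqr_sqrtr ?ler0n.
have gp : 0 < g by rewrite -(pmulr_lgt0 _ sN0); apply: lt_le_trans hg.
case: (leP g0 g) => hgg.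
  apply: (@le_trans _ _ (c1 * g)); last by rewrite ler_pM2r // -addrA lerDl addr_ge0.
  apply: perturbation_large => //; apply: le_trans (frobD _ _) _.
  rewrite /w -addrA; apply: lerD.
    by rewrite -!mulmxA mulmxA mulmxA; apply: frob_mul3.
  apply: le_trans hE1 _; rewrite [leLHS]addrC; apply: lerD.
    by rewrite ler_pdivrMr ?ltr0n // ler_peMr // ler1n.
  by rewrite lerBlDr lerDl invr_ge0 mulr_ge0 // ltW.
apply: (@le_trans _ _ (c2 * g)); last first.
  by rewrite ler_pM2r // [c1 + c2]addrC -addrA lerDl addr_ge0.
have [gs gK] : g < s / 2 /\ g < (2 * K + 1)^-1.
  by move: hgg; rewrite lt_min => /andP.
have hN : 2 * K + 1 < Num.sqrt N%:R.
  rewrite -(ltr_pM2l gp); apply: lt_le_trans hg.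
  by rewrite -ltr_pdivlMr // div1r.
have hKN : K / N%:R < (2 * Num.sqrt N%:R)^-1.
  rewrite [in X in X < _]NE.
  have -> : K / Num.sqrt N%:R ^+ 2 = (2 * K / Num.sqrt N%:R) * (2 * Num.sqrt N%:R)^-1.
    by field; rewrite gt_eqF.
  rewrite gtr_pMl ?invr_gt0 ?mulr_gt0 // ltr_pdivrMr // mul1r.
  by apply: lt_trans hN; rewrite ltrDl.
have hlt (E : 'M[C]_n) : frob E <= g - (2 * Num.sqrt N%:R)^-1 + K / N%:R -> frob E < g.
  move=> h; apply: le_lt_trans h _.
  by rewrite -addrA gtrDl addrC subr_lt0.
apply: (@perturbation_small _ n r P Q Qp Lam D D' E0 E1 s g kD) => //.
- move=> y; rewrite -ler_pdivlMl // invrK.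
  have -> : frob (Qp *m y) = frob (Qp *m D' *m pleft P *m (P *m D *m Q *m (Qp *m y))).
    rewrite -(mulmxA (P *m D)) (mulmxA Q) hQ mul1mx -(mulmxA P) -(mulmxA (Qp *m D')).
    by rewrite (mulmxA (pleft P)) (pleftK hP) mul1mx -(mulmxA Qp) (mulmxA D') (mulmx1C hD) mul1mx.
  apply: le_trans (frobM _ _) _; rewrite ler_wpM2r ?frob_ge0 //.
  apply: le_trans (frob_mul3 _ _ fD') _; by rewrite lerDl.
- exact: hlt.
- by apply: ltW; exact: hlt.
- exact: ltW.
Qed.

Lemma eigenvalue_split n r (P : 'M[C]_(n, r)) (rho : 'I_r -> C) (a : C) :
  (forall y : 'cV_r, P *m y = 0 -> y = 0) ->
  eigenvalue (P *m diag_mx (\row_i rho i) *m pleft P) a ->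
  a = 0 \/ exists i, a = rho i.
Proof.
move=> hP /eigenvalueP [v hv v0]; case: (eqVneq a 0) => [->|a0]; [by left|right].
set W := v *m P.
have hW : W *m diag_mx (\row_i rho i) = a *: W.
  rewrite /W scalemxAl -hv -[RHS](mulmxA v) -(mulmxA (P *m _)) (pleftK hP) mulmx1.
  by rewrite (mulmxA v).
have : W != 0.
  apply: contra v0 => /eqP W0; move: hv; rewrite (mulmxA v) (mulmxA v) -/W W0 !mul0mx => /esym/eqP.
  by rewrite scaler_eq0 (negbTE a0).
move: W hW => W hW /rV0Pn [j Wj]; exists j; apply/esym/(mulIf Wj).
have := congr1 (fun M : 'rV[C]_r => M 0 j) hW; rewrite mul_mx_diag !mxE.
by rewrite mulrC.
Qed.

End perturbation_bound.

(** * Genericity of the sampled directions *)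

Section hyperplane.
Variable R : realType.

Lemma householder d (a b : 'cV[R]_d) : a^T *m a = b^T *m b ->
  exists O : 'M[R]_d, O^T *m O = 1%:M /\ O^T *m a = b.
Proof.
move=> hab; case: (eqVneq a b) => [<-|ab].
  by exists 1%:M; rewrite trmx1 mulmx1 mul1mx.
pose v := a - b; pose q := (v^T *m v) 0 0.
have vv : v^T *m v = q%:M by rewrite [LHS]mx11_scalar.
have q0 : q != 0.
  have -> : q = \sum_i v i 0 ^+ 2.
    by rewrite /q mxE; apply: eq_bigr => i _; rewrite mxE expr2.
  apply: contra ab; rewrite psumr_eq0 => [|i _]; last exact: sqr_ge0.
  move=> /allP h; rewrite -subr_eq0; apply/eqP/colP => i; rewrite [RHS]mxE.
  by have := h i; rewrite mem_index_enum sqrf_eq0 => /(_ isT)/eqP.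
have ab' : a^T *m b = b^T *m a.
  by apply: trmx_inj; rewrite trmx_mul trmxK [LHS]mx11_scalar [RHS]mx11_scalar;
    congr scalar_mx; rewrite !mxE; apply: eq_bigr => i _; rewrite !mxE mulrC.
have va : v^T *m a = (q / 2)%:M.
  rewrite [LHS]mx11_scalar; congr scalar_mx; rewrite /q /v linearB /= !(mulmxBl, mulmxBr) -hab -ab'.
  have e (A B : 'M[R]_1) : (A - B) 0 0 = A 0 0 - B 0 0 by rewrite !mxE.
  by rewrite !e; field.
pose O : 'M[R]_d := 1%:M - (2 / q) *: (v *m v^T).
have OT : O^T = O.
  by rewrite /O linearB /= trmx1 linearZ /= trmx_mul trmxK.
exists O; rewrite OT; split.
  have WW : v *m v^T *m (v *m v^T) = q *: (v *m v^T).
    by rewrite mulmxA -(mulmxA v v^T v) vv mul_mx_scalar -scalemxAl.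
  rewrite /O mulmxBl mul1mx mulmxBr mulmx1 -scalemxAl -scalemxAr WW !scalerA.
  have -> : 2 / q * (2 / q) * q = 2 / q + 2 / q by field.
  rewrite scalerDl; move: ((2 / q) *: (v *m v^T)) => Z.
  by apply/matrixP => i j; rewrite !mxE; ring.
rewrite /O mulmxBl mul1mx -scalemxAl -mulmxA va mul_mx_scalar scalerA.
have -> : 2 / q * (q / 2) = 1 by field.
by rewrite scale1r /v opprB addrC subrK.
Qed.

Lemma borel_vec_coord d (i : 'I_d) (A : set R) : measurable A ->
  borel_vec ([set v | A (v i 0)] : set 'cV[R]_d).
Proof.
move=> mA; apply: sub_sigma_algebra.
rewrite (bigD1 i) //=; left; exists A => //.
by rewrite setTI.
Qed.

Local Notation Tv d := (g_sigma_algebraType (@borel_vec R d)).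

Lemma borel_vec_sigma d : sigma_algebra setT (@borel_vec R d).
Proof. exact: smallest_sigma_algebra. Qed.

Lemma Tv_measurableE d (A : set 'cV[R]_d) :
  (measurable : set (set (Tv d))) A = borel_vec A.
Proof. by rewrite measurable_g_measurableTypeE //; exact: borel_vec_sigma. Qed.

Lemma measurable_coord d (i : 'I_d) :
  measurable_fun setT (fun v : Tv d => (v : 'cV[R]_d) i 0).
Proof.
by move=> _ A mA; rewrite setTI Tv_measurableE; exact: borel_vec_coord.
Qed.

Lemma borel_hyperplane d (h : 'cV[R]_d) :
  borel_vec [set x : 'cV[R]_d | (h^T *m x) 0 0 = 0].
Proof.
rewrite -Tv_measurableE.
have mf : measurable_fun setT (fun x : Tv d => \sum_(i < d) h i 0 * (x : 'cV[R]_d) i 0).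
  by apply: measurable_sum => i; apply: measurable_funM => //; exact: measurable_coord.
have := mf measurableT [set 0] (measurable_set1 _); rewrite setTI.
set A := _ @^-1` _; set B := [set x | _]; suff -> : A = B by [].
by apply/seteqP; split => x; rewrite /A /B /= mxE => e; rewrite -[RHS]e;
  apply: eq_bigr => i _; rewrite mxE.
Qed.

(* Only d - 1 of the normals on the moment curve can be orthogonal to a nonzero
   vector, and by rotation invariance all hyperplanes have the same probability. *)
Lemma uniform_sphere_hyperplane (dO : measure_display) (Omega : measurableType dO)
    (P : probability Omega R) d (X : Omega -> 'cV[R]_d) (h : 'cV[R]_d) :
  uniform_sphere P X -> h != 0 -> P [set w | (h^T *m X w) 0 0 = 0] = 0%E.
Proof.
move=> [mX sX rX] h0.
pose H (g : 'cV[R]_d) := [set x : 'cV[R]_d | (g^T *m x) 0 0 = 0].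
have mH g : measurable (X @^-1` H g) by apply: mX; exact: borel_hyperplane.
have norm_gt0 (g : 'cV[R]_d) : g != 0 -> 0 < (g^T *m g) 0 0.
  move=> g0; have -> : (g^T *m g) 0 0 = \sum_i g i 0 ^+ 2.
    by rewrite mxE; apply: eq_bigr => i _; rewrite mxE expr2.
  rewrite lt_neqAle sumr_ge0 ?andbT => [|i _]; last exact: sqr_ge0.
  rewrite eq_sym; apply: contra g0; rewrite psumr_eq0 => [|i _]; last exact: sqr_ge0.
  move=> /allP h'; apply/eqP/colP => i; rewrite [RHS]mxE.
  by have := h' i; rewrite mem_index_enum sqrf_eq0 => /(_ isT)/eqP.
have same g : g != 0 -> P (X @^-1` H g) = P (X @^-1` H h).
  move=> g0; pose c := Num.sqrt ((h^T *m h) 0 0) / Num.sqrt ((g^T *m g) 0 0).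
  have c0 : c != 0 by rewrite gt_eqF // divr_gt0 // sqrtr_gt0 norm_gt0.
  have [|O [OO Oh]] := @householder d h (c *: g).
    have Tz : (c *: g)^T = c *: g^T by apply/matrixP => i j; rewrite !mxE.
    rewrite Tz -scalemxAl -scalemxAr scalerA.
    rewrite [LHS]mx11_scalar [X in _ *: X]mx11_scalar scale_scalar_mx; congr scalar_mx.
    rewrite /c mulrACA -invfM -!expr2 !sqr_sqrtr ?ltW ?norm_gt0 // divfK //.
    by rewrite gt_eqF // norm_gt0.
  have := rX O (H h) OO (borel_hyperplane h) => e.
  rewrite -[RHS]e; congr (P _); apply/seteqP; split => w; rewrite /H /= mulmxA;
   rewrite -[h^T *m O]trmxK trmx_mul trmxK Oh (_ : (c *: g)^T = c *: g^T) -?scalemxAl ?mxE;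
     do ?[by apply/matrixP => i j; rewrite !mxE].
    by move=> ->; rewrite mulr0.
  by move/eqP; rewrite mulf_eq0 (negbTE c0) => /eqP.
pose g i : 'cV[R]_d := \col_k (i%:R ^+ k).
case: (posnP d) => [d0|d0].
  by exfalso; move: h h0 {same mH norm_gt0 H}; rewrite d0 => h; rewrite [h]flatmx0 eqxx.
have g0 i : g i != 0.
  apply/eqP => /colP /(_ (Ordinal d0)); rewrite !mxE expr0 => /eqP.
  by rewrite oner_eq0.
have count w n : (\sum_(i < n) (\1_(X @^-1` H (g i)) w : R) <= d%:R)%R.
  pose p := \poly_(k < d) (X w (insubd (Ordinal d0) k) 0).
  have p0 : p != 0.
    apply/eqP => p0; have := sX w; rewrite /unit_sphere /= /vnorm.
    suff -> : \sum_(i < d) X w i 0 ^+ 2 = 0 by rewrite sqrtr0 => /esym/eqP; rewrite oner_eq0.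
    rewrite big1 // => i _; have := congr1 (fun q : {poly R} => q`_i) p0.
    rewrite coef_poly ltn_ord coef0 => e; rewrite (_ : X w i 0 = 0) ?expr0n // -[RHS]e.
    by congr (X w _ 0); apply/val_inj; rewrite val_insubd ltn_ord.
  pose s := [seq i <- iota 0 n | root p i%:R].
  have -> : \sum_(i < n) (\1_(X @^-1` H (g i)) w : R) = (size s)%:R.
    rewrite /s size_filter -sum1_count natr_sum -[in RHS](subn0 n) -/(index_iota 0 n).
    rewrite [RHS]big_mkord [RHS]big_mkcond /=; apply: eq_bigr => i _.
    rewrite indicE; case: ifPn => hr.
      suff -> : w \in X @^-1` H (g i) by [].
      rewrite inE /H /= mxE -[RHS](rootP hr) horner_poly; apply: eq_bigr => k _.
      by rewrite !mxE mulrC; congr (X w _ 0 * _); apply/val_inj; rewrite val_insubd ltn_ord.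
    suff /negbTE -> : w \notin X @^-1` H (g i) by [].
    apply: contra hr; rewrite inE /H /= mxE => e.
    apply/rootP; rewrite -[RHS]e horner_poly; apply: eq_bigr => k _.
    by rewrite !mxE mulrC; congr (_ * X w _ 0); apply/val_inj; rewrite val_insubd ltn_ord.
  rewrite ler_nat; rewrite -(size_map (fun i : nat => i%:R : R)).
  apply: ltnW; apply: leq_trans (size_poly d (fun k => X w (insubd (Ordinal d0) k) 0)).
  apply: max_poly_roots => //.
    by rewrite all_map; apply/allP => i; rewrite mem_filter => /andP [].
  rewrite map_inj_uniq ?filter_uniq ?iota_uniq // => i j /eqP.
  by rewrite eqr_nat => /eqP.
have bound n : (n%:R%:E * P (X @^-1` H h) <= d%:R%:E)%E.
  have -> : (n%:R%:E * P (X @^-1` H h) = \sum_(i < n) P (X @^-1` H (g i)))%E.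
    rewrite (eq_bigr (fun=> P (X @^-1` H h))) => [|i _]; last exact: same.
    by rewrite sumr_const card_ord mule_natl.
  have -> : (\sum_(i < n) P (X @^-1` H (g i)) =
      \int[P]_w (\sum_(i < n) (\1_(X @^-1` H (g i)) w)%:E))%E.
    rewrite ge0_integral_sum //; last first.
      by move=> i; apply/measurable_EFinP; exact: measurable_indic.
    by apply: eq_bigr => i _; rewrite integral_indic // setIT.
  apply: (@le_trans _ _ (\int[P]_w (cst d%:R%:E w))%E); last first.
    rewrite (integral_cst P measurableT) -[leRHS]mule1.
    by apply: lee_wpmul2l; [rewrite lee_fin|exact: probability_le1].
  apply: ge0_le_integral => //.
  - by move=> w _; apply: sume_ge0 => i _; rewrite lee_fin.
  - by apply: emeasurable_sum => i; apply/measurable_EFinP; exact: measurable_indic.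
  - by move=> w _; rewrite /= sumEFin lee_fin; exact: count.
have Pf : P (X @^-1` H h) \is a fin_num by exact: fin_num_measure.
rewrite -[LHS](fineK Pf); congr EFin; apply/eqP; rewrite eq_le; apply/andP; split; last first.
  by rewrite fine_ge0.
rewrite leNgt; apply/negP => p0.
have := bound (Num.truncn (d%:R / fine (P (X @^-1` H h)))).+1.
rewrite -(fineK Pf) -EFinM lee_fin leNgt => /negP; apply.
by rewrite -ltr_pdivrMr // truncnS_gt.
Qed.

End hyperplane.

Section complex_measurability.
Variables (R : realType) (d : measure_display) (T : measurableType d).
Local Notation C := R[i].
Implicit Types f g : T -> C.

Definition cmeas f := measurable_fun setT (fun x => complex.Re (f x)) /\
  measurable_fun setT (fun x => complex.Im (f x)).

Lemma cmeas_cst (c : C) : cmeas (fun=> c).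
Proof. by split; exact: measurable_cst. Qed.

Lemma cmeas_real (f : T -> R) : measurable_fun setT f -> cmeas (fun x => (f x)%:C%C).
Proof. by move=> mf; split => //; exact: measurable_cst. Qed.

Lemma cmeasD f g : cmeas f -> cmeas g -> cmeas (fun x => f x + g x).
Proof.
move=> [f1 f2] [g1 g2]; split.
  rewrite (_ : (fun _ => _) = (fun x => complex.Re (f x)) \+ (fun x => complex.Re (g x))).
    exact: measurable_funD.
  by apply/funext => x; rewrite raddfD.
rewrite (_ : (fun _ => _) = (fun x => complex.Im (f x)) \+ (fun x => complex.Im (g x))).
  exact: measurable_funD.
by apply/funext => x; rewrite raddfD.
Qed.

Lemma cmeasM f g : cmeas f -> cmeas g -> cmeas (fun x => f x * g x).
Proof.
move=> [f1 f2] [g1 g2]; split.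
  rewrite (_ : (fun _ => _) = (fun x => complex.Re (f x)) \* (fun x => complex.Re (g x))
      \- (fun x => complex.Im (f x)) \* (fun x => complex.Im (g x))).
    by apply: measurable_funB; exact: measurable_funM.
  by apply/funext => x /=; case: (f x) (g x) => a b [a' b'].
rewrite (_ : (fun _ => _) = (fun x => complex.Re (f x)) \* (fun x => complex.Im (g x))
    \+ (fun x => complex.Im (f x)) \* (fun x => complex.Re (g x))).
  by apply: measurable_funD; exact: measurable_funM.
by apply/funext => x /=; case: (f x) (g x) => a b [a' b'].
Qed.

Lemma cmeas_sum (I : Type) (s : seq I) (F : I -> T -> C) :
  (forall i, cmeas (F i)) -> cmeas (fun x => \sum_(i <- s) F i x).
Proof.
move=> h; elim: s => [|i s IH].
  by under eq_fun do rewrite big_nil; exact: cmeas_cst.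
by under eq_fun do rewrite big_cons; apply: cmeasD.
Qed.

Lemma cmeas_prod (I : Type) (s : seq I) (F : I -> T -> C) :
  (forall i, cmeas (F i)) -> cmeas (fun x => \prod_(i <- s) F i x).
Proof.
move=> h; elim: s => [|i s IH].
  by under eq_fun do rewrite big_nil; exact: cmeas_cst.
by under eq_fun do rewrite big_cons; apply: cmeasM.
Qed.

Lemma cmeas_det n (F : T -> 'M[C]_n) :
  (forall i j, cmeas (fun x => F x i j)) -> cmeas (fun x => \det (F x)).
Proof.
move=> h; apply: cmeas_sum => s; apply: cmeasM; first exact: cmeas_cst.
by apply: cmeas_prod => i; exact: h.
Qed.

Lemma cmeas_eq0 f : cmeas f -> measurable [set x | f x = 0].
Proof.
move=> [f1 f2].
have -> : [set x | f x = 0] = (fun x => complex.Re (f x)) @^-1` [set 0] `&`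
    (fun x => complex.Im (f x)) @^-1` [set 0].
  apply/seteqP; split => x /=; first by move=> ->.
  by case: (f x) => a b /= [-> ->].
by apply: measurableI; rewrite -[X in measurable X]setTI; [apply: f1|apply: f2] => //;
  exact: measurable_set1.
Qed.

End complex_measurability.

Section independence.
Variable R : realType.
Local Notation C := R[i].
Context {dO : measure_display} {Omega : measurableType dO}.
Variable P : probability Omega R.

Lemma independent_section_null d1 d2 (T1 : measurableType d1) (T2 : measurableType d2)
    (Y : Omega -> T1) (Z : Omega -> T2) (S : set (T1 * T2)) :
  measurable_fun setT Y -> measurable_fun setT Z ->
  (forall A B, measurable A -> measurable B ->
     P (Y @^-1` A `&` Z @^-1` B) = (P (Y @^-1` A) * P (Z @^-1` B))%E) ->
  measurable S -> (forall y, P [set w | S (y, Z w)] = 0%E) ->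
  P [set w | S (Y w, Z w)] = 0%E.
Proof.
move=> mY mZ ind mS S0; pose YZ w := (Y w, Z w).
have mYZ : measurable_fun setT YZ by exact: measurable_fun_pair.
pose fY : {mfun Omega >-> T1} := HB.pack Y (isMeasurableFun.Build _ _ _ _ _ mY).
pose fZ : {mfun Omega >-> T2} := HB.pack Z (isMeasurableFun.Build _ _ _ _ _ mZ).
pose fYZ : {mfun Omega >-> (T1 * T2)%type} :=
  HB.pack YZ (isMeasurableFun.Build _ _ _ _ _ mYZ).
have h := @product_measure_unique _ _ T1 T2 R (distribution P fY) (distribution P fZ)
  (distribution P fYZ) ind S mS.
have -> : P [set w | S (Y w, Z w)] = distribution P fYZ S by [].
rewrite -h /product_measure1; apply: integral0_eq => y _ /=.
rewrite -[RHS](S0 y) /distribution /pushforward; congr (P _).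
by apply/seteqP; split => w /=; rewrite /xsection /= inE.
Qed.

Variables (n d : nat) (xt : 'I_n -> Omega -> 'cV[R]_d).
Hypothesis indep : independent_vecs P xt.
Hypothesis mxt : forall m, vec_measurable measurable (xt m).

Definition rectangles (m : 'I_n) : set (set ('I_n -> 'cV[R]_d)) :=
  [set A | exists B : 'I_n -> set 'cV[R]_d, [/\ (forall i, borel_vec (B i)),
    B m = setT & A = [set f | forall i, B i (f i)]]].

Local Notation T1 m := (g_sigma_algebraType (rectangles m)).
Local Notation T2 := (g_sigma_algebraType (@borel_vec R d)).

Lemma borel_vecT : borel_vec (setT : set 'cV[R]_d).
Proof. by rewrite -Tv_measurableE; exact: measurableT. Qed.

Lemma borel_vecI (A B : set 'cV[R]_d) : borel_vec A -> borel_vec B -> borel_vec (A `&` B).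
Proof. by rewrite -!Tv_measurableE; exact: measurableI. Qed.

Lemma measurable_coord_rect m k (i : 'I_d) : k != m ->
  measurable_fun setT (fun f : T1 m => (f : 'I_n -> 'cV[R]_d) k i 0).
Proof.
move=> km _ A mA; rewrite setTI; apply: sub_sigma_algebra.
exists (fun j => if j == k then [set v : 'cV[R]_d | A (v i 0)] else setT); split.
- by move=> j; case: ifP => _; [exact: borel_vec_coord|exact: borel_vecT].
- by rewrite eq_sym (negbTE km).
apply/seteqP; split => f /=.
  by move=> Af j; case: eqP => [->|//].
by move=> /(_ k); rewrite eqxx.
Qed.

Lemma measurable_xt m : measurable_fun setT (xt m : Omega -> T2).
Proof. by move=> _ A mA; rewrite setTI; apply: mxt; rewrite -Tv_measurableE. Qed.

Lemma rect_preimage (B : 'I_n -> set 'cV[R]_d) :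
  (fun w i => xt i w) @^-1` [set f | forall i, B i (f i)] = \bigcap_i (xt i @^-1` B i).
Proof. by apply/seteqP; split => w /= h i; [move=> _|]; exact: h. Qed.

Lemma measurable_family m : measurable_fun setT ((fun w i => xt i w) : Omega -> T1 m).
Proof.
apply: (@measurability _ _ Omega (T1 m) setT _ (rectangles m) erefl) => _ [_ [B [mB Bm ->]] <-].
rewrite setTI rect_preimage; apply: fin_bigcap_measurable => // i _.
by apply: mxt.
Qed.

Lemma independent_rect m (A : set (T1 m)) (D : set T2) :
  measurable A -> measurable D ->
  P ((fun w i => xt i w) @^-1` A `&` xt m @^-1` D) =
  (P ((fun w i => xt i w) @^-1` A) * P (xt m @^-1` D))%E.
Proof.
move=> mA mD; pose Y : Omega -> T1 m := fun w i => xt i w.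
have mY : measurable_fun setT Y by exact: measurable_family.
have mZD : measurable (xt m @^-1` D) by apply: mxt; rewrite -Tv_measurableE.
have pf : P (xt m @^-1` D) \is a fin_num by exact: fin_num_measure.
have p0 : 0 <= fine (P (xt m @^-1` D)) by rewrite fine_ge0.
suff e : mrestr P mZD (Y @^-1` A) = mscale (NngNum p0) P (Y @^-1` A).
  have -> : P (Y @^-1` A `&` xt m @^-1` D) = mrestr P mZD (Y @^-1` A) by [].
  by rewrite e /mscale /= fineK // muleC.
apply: (@g_sigma_algebra_measure_unique _ R Omega
  (preimage_set_system setT Y (rectangles m)) _ (fun=> setT)).
- move=> _ [B mB <-]; rewrite setTI -[X in measurable X]setTI; apply: mY => //.
  exact: sub_sigma_algebra.
- move=> _; exists setT; last by rewrite setTI.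
  exists (fun=> setT); split => //; first by move=> _; exact: borel_vecT.
  by apply/seteqP; split.
- by rewrite bigcup_const.
- move=> _ _ [_ [B1 [m1 e1 ->]] <-] [_ [B2 [m2 e2 ->]] <-].
  exists [set f | forall i, (B1 i `&` B2 i) (f i)].
    exists (fun i => B1 i `&` B2 i); split => //.
      by move=> i; exact: borel_vecI.
    by rewrite e1 e2 setTI.
  rewrite !setTI; apply/seteqP; split => w /=.
    by move=> h; split => i; have [] := h i.
  by move=> [h1 h2] i; split; [exact: h1|exact: h2].
- move=> _ [_ [B [mB Bm ->]] <-]; rewrite setTI.
  have -> : Y @^-1` [set f | forall i, B i (f i)] = \bigcap_i (xt i @^-1` B i).
    exact: rect_preimage.
  pose B' i := if i == m then D else B i.
  have mB' i : borel_vec (B' i).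
    by rewrite /B'; case: eqP => // _; rewrite -Tv_measurableE.
  rewrite /= /mrestr.
  have -> : (\bigcap_i (xt i @^-1` B i)) `&` xt m @^-1` D = \bigcap_i (xt i @^-1` B' i).
    apply/seteqP; split => w /=.
      by move=> [h1 h2] i _; rewrite /= /B'; case: eqP => [->//|_]; exact: h1.
    move=> h; split; last by have := h m I; rewrite /= /B' eqxx.
    move=> i _ /=; have := h i I; rewrite /= /B'; case: eqP => [->|//].
    by rewrite Bm.
  rewrite /mscale /= fineK // (indep mB') (indep mB) (bigD1 m) //= /B' eqxx; congr (_ * _)%E.
  rewrite [RHS](bigD1 m) //= Bm preimage_setT probability_setT mul1e.
  by apply: eq_bigr => i /negbTE ->.
- move=> _; rewrite /= /mrestr setTI; by rewrite -ge0_fin_numE.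
- have := g_sigma_preimageE setT Y (rectangles m) => ->.
  by exists A => //; rewrite setTI.
Qed.

End independence.

Section generic_determinant.
Variable R : realType.
Local Notation C := R[i].

Definition dotc d (u : 'cV[C]_d) (x : 'cV[R]_d) : C := \sum_i u i 0 * (x i 0)%:C%C.

Lemma dotc_sum d (I : Type) (s : seq I) (b : I -> C) (u : I -> 'cV[C]_d) (x : 'cV[R]_d) :
  dotc (\sum_(j <- s) b j *: u j) x = \sum_(j <- s) b j * dotc (u j) x.
Proof.
rewrite /dotc; under [RHS]eq_bigr do rewrite mulr_sumr.
rewrite exchange_big; apply: eq_bigr => i _ /=.
rewrite summxE mulr_suml; apply: eq_bigr => j _.
by rewrite mxE mulrA.
Qed.

Context {dO : measure_display} {Omega : measurableType dO}.
Variable P : probability Omega R.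

Lemma uniform_sphere_dotc d (X : Omega -> 'cV[R]_d) (h : 'cV[C]_d) :
  uniform_sphere P X -> h != 0 -> P [set w | dotc h (X w) = 0] = 0%E.
Proof.
move=> uX h0; have mX : vec_measurable measurable X by case: uX.
have mdot : measurable [set w | dotc h (X w) = 0].
  apply: cmeas_eq0; apply: cmeas_sum => i; apply: cmeasM; first exact: cmeas_cst.
  apply: cmeas_real => _ A mA; rewrite setTI.
  exact: (mX _ (borel_vec_coord i mA)).
have sub (g : 'cV[R]_d) : (forall x, dotc h x = 0 -> (g^T *m x) 0 0 = 0) -> g != 0 ->
    P [set w | dotc h (X w) = 0] = 0%E.
  move=> hg g0; apply/eqP; rewrite eq_le measure_ge0 andbT.
  rewrite -(uniform_sphere_hyperplane uX g0); apply: le_measure.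
  - by rewrite inE.
  - by rewrite inE; apply: (mX _ (borel_hyperplane g)).
  - by move=> w /= /hg.
have dotE x : dotc h x = ((\sum_i complex.Re (h i 0) * x i 0) +i* (\sum_i complex.Im (h i
  0) * x i 0))%C.
  rewrite /dotc; apply/eqP; rewrite eq_complex /= !raddf_sum /=.
  by apply/andP; split; apply/eqP; apply: eq_bigr => i _; case: (h i 0) => a b /=; ring.
case: (eqVneq (\col_i complex.Re (h i 0)) 0) => [re0|]; last first.
  apply: sub => x; rewrite dotE => -[e _]; rewrite mxE -[RHS]e.
  by apply: eq_bigr => i _; rewrite !mxE.
case: (eqVneq (\col_i complex.Im (h i 0)) 0) => [im0|]; last first.
  apply: sub => x; rewrite dotE => -[_ e]; rewrite mxE -[RHS]e.
  by apply: eq_bigr => i _; rewrite !mxE.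
case/eqP: h0; apply/colP => i.
move/colP: re0 => /(_ i); move/colP: im0 => /(_ i); rewrite !mxE.
by case: (h i 0) => a b /= -> ->.
Qed.

Definition gen_mx n d (c : nat -> nat -> C) (u : nat -> 'cV[C]_d) (idx : nat -> 'I_n)
    (m : nat) (X : 'I_n -> 'cV[R]_d) : 'M[C]_m :=
  \matrix_(k < m, j < m) (c k j * dotc (u j) (X (idx k))).

Variables (n d : nat) (xt : 'I_n -> Omega -> 'cV[R]_d).
Hypothesis indep : independent_vecs P xt.
Hypothesis unif : forall m, uniform_sphere P (xt m).

Lemma generic_gen_mx (c : nat -> nat -> C) (u : nat -> 'cV[C]_d) (idx : nat -> 'I_n) r :
  (forall k j, c k j != 0) ->
  (forall m (b : 'I_m -> C), (m <= r)%N -> \sum_j b j *: u j = 0 -> forall j, b j = 0) ->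
  (forall i j, (i < r)%N -> (j < r)%N -> idx i = idx j -> i = j) ->
  forall m, (m <= r)%N ->
  measurable [set w | \det (gen_mx c u idx m (fun k => xt k w)) = 0] /\
  P [set w | \det (gen_mx c u idx m (fun k => xt k w)) = 0] = 0%E.
Proof.
move=> hc hu hidx.
have mxt k : vec_measurable measurable (xt k) by case: (unif k).
have mdet m : measurable [set w | \det (gen_mx c u idx m (fun k => xt k w)) = 0].
  apply: cmeas_eq0; apply: cmeas_det => k j.
  rewrite (_ : (fun _ => _) = (fun w => c k j * dotc (u j) (xt (idx k) w))); last first.
    by apply/funext => w; rewrite mxE.
  apply: cmeasM; first exact: cmeas_cst.
  apply: cmeas_sum => i; apply: cmeasM; first exact: cmeas_cst.
  apply: cmeas_real => _ A mA; rewrite setTI.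
  exact: (mxt _ _ (borel_vec_coord i mA)).
elim=> [|m IH] mr; split; [exact: mdet| |exact: mdet|].
  rewrite (_ : mkset _ = set0) ?measure0 //; apply/seteqP; split => // w /=.
  by rewrite det_mx00 => /eqP; rewrite oner_eq0.
have [_ IHm] := IH (ltnW mr).
pose m0 := idx m.
have idxm k : (k < m)%N -> idx k != m0.
  move=> km; apply/eqP => /hidx e; have := e (ltn_trans km mr) mr.
  by move=> ek; rewrite ek ltnn in km.
pose T1 := g_sigma_algebraType (@rectangles R n d m0).
pose T2 := g_sigma_algebraType (@borel_vec R d).
pose upd (X : 'I_n -> 'cV[R]_d) z k := if k == m0 then z else X k.
pose D k (p : T1 * T2) := \det (gen_mx c u idx k (upd p.1 p.2)).
have mD k : (k <= m.+1)%N -> cmeas (D k).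
  move=> km; apply: cmeas_det => i j.
  rewrite (_ : (fun _ => _) = (fun p : T1 * T2 => c i j * dotc (u j) (upd p.1 p.2 (idx
    i)))); last first.
    by apply/funext => p; rewrite mxE.
  apply: cmeasM; first exact: cmeas_cst.
  apply: cmeas_sum => l; apply: cmeasM; first exact: cmeas_cst.
  apply: cmeas_real; rewrite /upd; case: (eqVneq (idx i) m0) => e.
    exact: (measurableT_comp (measurable_coord l) measurable_snd).
  exact: (measurableT_comp (measurable_coord_rect l e) measurable_fst).
pose S := [set p | D m p != 0 /\ D m.+1 p = 0].
have mS : measurable S.
  rewrite (_ : S = ~` [set p | D m p = 0] `&` [set p | D m.+1 p = 0]).
    by apply: measurableI; [apply: measurableC|]; apply: cmeas_eq0; apply: mD.
  by apply/seteqP; split => p [/= h1 h2]; split => //; apply/eqP.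
have S0 : P [set w | S ((fun k => xt k w), xt m0 w)] = 0%E.
  apply: (@independent_section_null R _ _ P _ _ T1 T2 (fun w k => xt k w) (xt m0)) => //.
  - exact: measurable_family.
  - exact: measurable_xt.
  - exact: independent_rect.
  move=> X; case: (eqVneq (D m (X, 0)) 0) => [e|e].
    rewrite (_ : mkset _ = set0) ?measure0 //; apply/seteqP; split => // w [/= + _].
    suff -> : D m (X, xt m0 w) = D m (X, 0) by rewrite e eqxx.
    congr (\det _); apply/matrixP => i j; rewrite !mxE /upd.
    by rewrite (negbTE (idxm _ (ltn_ord i))).
  pose A z := gen_mx c u idx m.+1 (upd X z).
  have cofE z j : cofactor (A z) ord_max j = cofactor (A 0) ord_max j.
    congr (_ * \det _); apply/matrixP => i k; rewrite !mxE /upd.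
    suff /negbTE -> : idx (lift ord_max i) != m0 by [].
    by apply: idxm; rewrite lift_max.
  pose b (j : 'I_m.+1) := cofactor (A 0) ord_max j * c m j.
  have bE : D m (X, 0) = cofactor (A 0) ord_max ord_max.
    rewrite /cofactor -signr_odd addnn odd_double expr0 mul1r; congr (\det _).
    by apply/matrixP => i j; rewrite !mxE !lift_max.
  have h0 : \sum_j b j *: u j != 0.
    apply/eqP => /(hu _ b mr) /(_ ord_max); rewrite /b -bE => /eqP.
    by rewrite mulf_eq0 (negbTE e) (negbTE (hc _ _)).
  have sub : [set w | S (X, xt m0 w)] `<=` [set w | dotc (\sum_j b j *: u j) (xt m0 w) = 0].
    move=> w [/= _]; rewrite /D /= (expand_det_row _ ord_max) dotc_sum => hD; rewrite -[RHS]hD.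
    apply: eq_bigr => j _; rewrite -/(A _) cofE /b [A _ _ _]mxE /upd eqxx /=.
    by ring.
  have mZ : measurable [set w | S (X, xt m0 w)].
    rewrite (_ : mkset _ = xt m0 @^-1` (xsection S X)).
      by apply: mxt; rewrite -Tv_measurableE; exact: measurable_xsection.
    by apply/seteqP; split => w /=; rewrite /xsection /= inE.
  apply/eqP; rewrite eq_le measure_ge0 andbT -(uniform_sphere_dotc (unif m0) h0).
  apply: le_measure => //; rewrite inE //.
  apply: cmeas_eq0; apply: cmeas_sum => i; apply: cmeasM; first exact: cmeas_cst.
  apply: cmeas_real => _ B mB; rewrite setTI.
  exact: (mxt _ _ (borel_vec_coord i mB)).
have updE w : upd (fun k => xt k w) (xt m0 w) = (fun k => xt k w).
  by apply/funext => k; rewrite /upd; case: eqP => [->|].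
set A := [set w | \det (gen_mx c u idx m.+1 _) = 0].
set B := [set w | \det (gen_mx c u idx m _) = 0] in IHm.
have mSw : measurable [set w | S ((fun k => xt k w), xt m0 w)].
  rewrite (_ : mkset _ = A `\` B); first by apply: measurableD; exact: mdet.
  apply/seteqP; split => w; rewrite /S /D /A /B /= updE.
    by move=> [h1 h2]; split => //; apply/eqP.
  by move=> [h1 h2]; split => //; apply/eqP.
apply/eqP; rewrite eq_le measure_ge0 andbT.
rewrite -[leRHS](adde0 0%E) -{1}IHm -{1}S0.
apply: le_trans (measureU2 _ _ _); [|exact: mdet|exact: mSw].
apply: le_measure; rewrite ?inE; [exact: mdet|by apply: measurableU => //; exact: mdet|].
move=> w hA; case: (pselect (B w)) => hB; [by left|right].
by rewrite /S /D /= updE; split => //; apply/eqP.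
Qed.

End generic_determinant.

(** * Sub-Gaussian noise *)

Section conditional_mgf.
Variable R : realType.
Context {dO : measure_display} {Omega : measurableType dO}.
Variable P : probability Omega R.
Local Notation leb := (@lebesgue_measure R).

Definition layer (Z : Omega -> R) : set (Omega * R) := [set p | 0 <= p.2 < Z p.1].

Lemma measurable_layer (Z : Omega -> R) : measurable_fun setT Z -> measurable (layer Z).
Proof.
move=> mZ; have mb : measurable_fun setT (fun p : Omega * R => (0 <= p.2) && (p.2 < Z p.1)).
  apply: measurable_and.
    by apply: measurable_fun_ler => //; exact: measurable_snd.
  apply: measurable_fun_ltr; first exact: measurable_snd.
  exact: measurableT_comp mZ measurable_fst.
by have := mb measurableT [set true] I; rewrite setTI.
Qed.

Lemma layer_cake (X Z : Omega -> R) :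
  measurable_fun setT X -> measurable_fun setT Z ->
  (forall w, 0 <= X w) -> (forall w, 0 <= Z w) ->
  (\int[P]_w (Z w * X w)%:E =
   \int[leb]_t \int[P]_(w in [set w | (0 <= t < Z w)%R]) (X w)%:E)%E /\
  measurable_fun setT (fun t : R => \int[P]_(w in [set w | (0 <= t < Z w)%R]) (X w)%:E)%E.
Proof.
move=> mX mZ X0 Z0; have mA := measurable_layer mZ.
pose f (p : Omega * R) : \bar R := (X p.1 * \1_(layer Z) p)%:E.
have mf : measurable_fun setT f.
  apply/measurable_EFinP; apply: measurable_funM; last exact: measurable_indic.
  exact: measurableT_comp mX measurable_fst.
have f0 p : (0 <= f p)%E by rewrite lee_fin mulr_ge0.
have inG t : (\int[P]_w f (w, t) = \int[P]_(w in [set w | (0 <= t < Z w)%R]) (X w)%:E)%E.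
  rewrite [RHS]integral_mkcond; apply: eq_integral => w _.
  rewrite patchE /f indicE /=; case: ifPn => [/set_mem h|/negP h].
    suff -> : (w, t) \in layer Z by rewrite mulr1.
    exact/mem_set.
  suff /negbTE -> : (w, t) \notin layer Z by rewrite mulr0.
  by apply/negP => /set_mem h'; apply: h; apply/mem_set.
have inF w : (\int[leb]_t f (w, t) = (Z w * X w)%:E)%E.
  have -> : (\int[leb]_t f (w, t) = \int[leb]_t ((X w)%:E * (\1_(`[0, Z w[%classic) t)%:E))%E.
    apply: eq_integral => t _; rewrite /f EFinM !indicE.
    suff -> : ((w, t) \in layer Z) = (t \in `[0, Z w[%classic) by [].
    by apply/idP/idP => /set_mem h; apply/mem_set; move: h; rewrite /layer /= in_itv.
  have hZ : leb (`[0, Z w[%classic) = (Z w)%:E.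
    rewrite lebesgue_measure_itv /= lte_fin; case: ltP => [_|h]; first by rewrite sube0.
    by congr EFin; apply/eqP; rewrite eq_le h Z0.
  rewrite ge0_integralZl //; last by rewrite lee_fin.
    rewrite integral_indic; [|exact: measurableT|exact: measurable_itv].
    have h (e : \bar R) : e = leb (`[0, Z w[%classic) ->
      ((X w)%:E * e = (Z w * X w)%:E)%E by move=> ->; rewrite hZ -EFinM mulrC.
    by apply: h; rewrite setIT.
  by apply/measurable_EFinP; apply: measurable_indic; exact: measurable_itv.
split; last first.
  have -> : (fun t : R => \int[P]_(w in [set w | (0 <= t < Z w)%R]) (X w)%:E)%E =
      (fun t : R => \int[P]_w f (w, t))%E by apply/funext => t; rewrite inG.
  exact: (measurable_fun_fubini_tonelli_G (m1 := P) f mf f0).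
rewrite (eq_integral (fun w => \int[leb]_t f (w, t))%E); last by move=> w _; rewrite inF.
rewrite (fubini_tonelli (m1 := P) (m2 := leb) f mf f0).
by apply: eq_integral => t _; exact: inG.
Qed.

Lemma condexp_set_le (G : set (set Omega)) (X Y : Omega -> R) (c : R) (A : set Omega) :
  is_condexp P G X Y -> G `<=` measurable -> 0 <= c -> {ae P, forall w, Y w <= c} -> G A ->
  (\int[P]_(w in A) (X w)%:E <= \int[P]_(w in A) c%:E)%E.
Proof.
move=> [iX iY mY eXY] Gm c0 Yc GA; rewrite -eXY //.
have mA := Gm _ GA.
have iYA : P.-integrable A (EFin \o Y) by apply: integrableS iY.
have mYA : measurable_fun A Y.
  by move/integrableP: iYA => [/measurable_EFinP].
pose Y' w := Num.min (Num.max (Y w) 0) c.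
apply: (@le_trans _ _ (\int[P]_(w in A) (Num.max (Y w) 0)%:E)%E).
  apply: le_integral => //.
    have := integrable_funepos mA iYA; apply: eq_integrable => // w _.
    by rewrite funeposE /= EFin_max.
  by move=> w _; rewrite lee_fin le_max lexx.
rewrite (ae_eq_integral (EFin \o Y')) //.
- apply: ge0_le_integral => //.
  + by move=> w _; rewrite lee_fin le_min le_max lexx orbT c0.
  + by apply/measurable_EFinP; apply: measurable_minr => //; apply: measurable_maxr.
  + by move=> w _; rewrite lee_fin ge_min lexx orbT.
- by apply/measurable_EFinP; apply: measurable_maxr.
- by apply/measurable_EFinP; apply: measurable_minr => //; apply: measurable_maxr.
- apply: filterS Yc => w Yc _; rewrite /Y' /=; congr EFin.
  by rewrite [RHS]min_l // ge_max Yc.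
Qed.

Lemma sigma_algebra_measurable_fun (G : set (set Omega)) (X : Omega -> R) :
  sigma_algebra setT G -> real_measurable G X <->
  measurable_fun setT (X : g_sigma_algebraType G -> R).
Proof.
move=> sG; split => h.
  by move=> _ A mA; rewrite setTI measurable_g_measurableTypeE //; exact: h.
by move=> A mA; have := h measurableT A mA; rewrite setTI measurable_g_measurableTypeE.
Qed.

Lemma condexp_mul_le (G : set (set Omega)) (X Y Z : Omega -> R) (c : R) :
  sigma_algebra setT G -> G `<=` measurable ->
  is_condexp P G X Y -> 0 <= c -> {ae P, forall w, Y w <= c} ->
  real_measurable G Z -> (forall w, 0 <= X w) -> (forall w, 0 <= Z w) ->
  (\int[P]_w (Z w * X w)%:E <= c%:E * \int[P]_w (Z w)%:E)%E.
Proof.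
move=> sG Gm hXY c0 Yc GZ X0 Z0.
have mX : measurable_fun setT X.
  by case: hXY => /integrableP [/measurable_EFinP].
have mZ : measurable_fun setT Z.
  by move=> _ A mA; rewrite setTI; apply: Gm; exact: GZ.
have GA t : G [set w | 0 <= t < Z w].
  case: (boolP (0 <= t)) => t0; last first.
    by rewrite (_ : mkset _ = set0); [case: sG|apply/seteqP; split].
  have := GZ `]t, +oo[%classic (measurable_itv _).
  by congr G; apply/seteqP; split => w /=; rewrite in_itv /= andbT.
have [-> m1] := layer_cake mX mZ X0 Z0.
have [e2 m2] := layer_cake (@measurable_cst _ _ _ _ setT c) mZ (fun=> c0) Z0.
apply: (@le_trans _ _ (\int[leb]_t \int[P]_(w in [set w | (0 <= t < Z w)%R]) c%:E)%E).
  apply: ge0_le_integral => //.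
  - by move=> t _; apply: integral_ge0 => w _; rewrite lee_fin.
  - by move=> t _; apply: condexp_set_le hXY _ _ _ _.
rewrite -e2 -ge0_integralZl //.
- by apply: ge0_le_integral => //;
   [move=> w _; rewrite lee_fin mulr_ge0|apply/measurable_EFinP; apply: measurable_funM
   |apply/measurable_EFinP; apply: measurable_funM|move=> w _; rewrite -EFinM mulrC].
- exact/measurable_EFinP.
- by move=> w _; rewrite lee_fin.
Qed.

Variables (d : nat) (F : nat -> set (set Omega)) (sigma : R)
  (x : nat -> Omega -> 'cV[R]_d) (eta : nat -> Omega -> R).
Hypothesis hsub : cond_subgaussian P F sigma x eta.

Lemma noise_measurable t : (1 <= t)%N -> measurable_fun setT (eta t).
Proof.
case: hsub => [[_ Fm _] [_ [meta _]]] t1 _ A mA; rewrite setTI.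
by apply: (Fm t); apply: (meta t t) => //; rewrite t1 leqnn.
Qed.

Lemma mgf_noise_sum (a : nat -> R) (t : nat -> nat) n :
  (forall j, 1 <= t j)%N -> (forall i j, (i < j)%N -> (t i < t j)%N) ->
  (\int[P]_w (expR (\sum_(j < n) a j * eta (t j) w))%:E <=
    (expR (\sum_(j < n) a j ^+ 2 * sigma ^+ 2 / 2))%:E)%E.
Proof.
move=> t1 tmono; elim: n => [|n IH].
  under eq_integral do rewrite big_ord0 expR0.
  by rewrite big_ord0 expR0 (integral_cst P measurableT) mul1e; exact: probability_le1.
case: (hsub) => [[sF Fm Fmono] [_ [meta hsg]]].
have [_ _ /(_ (a n)) [Y hY Yc]] := hsg _ (t1 n).
under eq_integral do rewrite big_ord_recr expRD.
rewrite [in leRHS]big_ord_recr /= expRD EFinM.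
have GZ : real_measurable (F (t n).-1) (fun w => expR (\sum_(j < n) a j * eta (t j) w)).
  apply/sigma_algebra_measurable_fun => //.
  apply: measurableT_comp; first exact: measurable_expR.
  have hm j : (j < n)%N -> measurable_fun setT (eta (t j) : g_sigma_algebraType (F (t n).-1) -> R).
    move=> jn; apply/sigma_algebra_measurable_fun => //; apply: meta.
    by rewrite t1 /= -ltnS prednK // tmono.
  have -> : (fun w => \sum_(j < n) a j * eta (t j) w) =
      (fun w => \sum_(j < n) a j * (if (j < n)%N then eta (t j) w else 0)).
    by apply/funext => w; apply: eq_bigr => j _; rewrite ltn_ord.
  apply: (@measurable_sum _ (g_sigma_algebraType (F (t n).-1)) R setT _ _ (fun (j : 'I_n) w
    => a j * (if (j < n)%N then eta (t j) w else 0))).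
  move=> j; apply: measurable_funM; first exact: measurable_cst.
  by rewrite ltn_ord; exact: hm.
apply: le_trans.
  apply: (condexp_mul_le (sF _) (@Fm _) hY _ Yc GZ) => [|w|w]; exact: expR_ge0.
rewrite muleC; apply: lee_pmul => //; rewrite ?lee_fin ?expR_ge0 //.
by apply: integral_ge0 => w _; rewrite lee_fin expR_ge0.
Qed.

Lemma noise_sum_measurable (a : nat -> R) (t : nat -> nat) n :
  (forall j, 1 <= t j)%N -> measurable_fun setT (fun w => \sum_(j < n) a j * eta (t j) w).
Proof.
move=> t1; apply: measurable_sum => j; apply: measurable_funM; first exact: measurable_cst.
exact: noise_measurable.
Qed.

Lemma noise_sum_tail (a : nat -> R) (t : nat -> nat) n (lam s ell : R) :
  (forall j, 1 <= t j)%N -> (forall i j, (i < j)%N -> (t i < t j)%N) ->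
  0 < lam -> 0 <= sigma <= s ->
  (P [set w | lam * s ^+ 2 * (\sum_(j < n) a j ^+ 2) / 2 + ell / lam <=
     \sum_(j < n) a j * eta (t j) w]%R <= (expR (- ell))%:E)%E.
Proof.
move=> t1 tmono lam0 /andP [sg0 sgs].
set V := \sum_(j < n) a j ^+ 2; set A := [set w | _].
pose S w := \sum_(j < n) lam * a j * eta (t j) w.
have SE w : S w = lam * \sum_(j < n) a j * eta (t j) w.
  by rewrite /S mulr_sumr; apply: eq_bigr => j _; rewrite mulrA.
have mS : measurable_fun setT S by exact: (noise_sum_measurable (fun j => lam * a j)).
have mA : measurable A.
  have := measurable_fun_ler (@measurable_cst _ _ Omega R setT (lam * s ^+ 2 * V / 2 + ell / lam))
    (noise_sum_measurable a n t1).
  by move=> /(_ measurableT [set true] I); rewrite setTI.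
pose c := lam ^+ 2 * s ^+ 2 * V / 2 + ell.
have h1 : ((expR c)%:E * P A <= \int[P]_w (expR (S w))%:E)%E.
  have -> : ((expR c)%:E * P A = \int[P]_w ((expR c)%:E * (\1_A w)%:E))%E.
    rewrite ge0_integralZl //; first by rewrite integral_indic // setIT.
    by apply/measurable_EFinP; exact: measurable_indic.
  apply: ge0_le_integral => //.
  - apply/measurable_EFinP; apply: measurable_funM => //; exact: measurable_indic.
  - apply/measurable_EFinP; apply: measurableT_comp => //; exact: measurable_expR.
  - move=> w _; rewrite -EFinM lee_fin indicE; case: (boolP (w \in A));
    rewrite ?mulr0 ?expR_ge0 // mulr1.
    rewrite inE /A /= => h; rewrite ler_expR SE /c.
    have -> : lam ^+ 2 * s ^+ 2 * V / 2 + ell = lam * (lam * s ^+ 2 * V / 2 + ell / lam).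
      by field; rewrite gt_eqF.
    by rewrite ler_pM2l.
have h2 := le_trans h1 (mgf_noise_sum (fun j => lam * a j) n t1 tmono).
have pf : P A \is a fin_num by exact: fin_num_measure.
move: h2; rewrite -(fineK pf) -EFinM !lee_fin => h2.
rewrite -(ler_pM2l (expR_gt0 c)) -expRD; apply: le_trans h2 _.
rewrite ler_expR /c addrK -mulr_suml -mulr_suml ler_pM2r ?invr_gt0 //.
have -> : \sum_(j < n) (lam * a j) ^+ 2 = lam ^+ 2 * V.
  by rewrite /V mulr_sumr; apply: eq_bigr => j _; rewrite exprMn.
rewrite [leRHS]mulrAC ler_wpM2l //.
  by rewrite mulr_ge0 ?sqr_ge0 // sumr_ge0 // => j _; exact: sqr_ge0.
by rewrite ler_pXn2r ?nnegrE // (le_trans sg0).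
Qed.

End conditional_mgf.

Section noise_event.
Variable R : realType.
Local Notation C := R[i].

Lemma union_bound (dO : measure_display) (Omega : measurableType dO)
    (P : probability Omega R) (I : finType) (B : I -> set Omega) (p : R) :
  (forall i, measurable (B i)) -> (forall i, P (B i) <= p%:E)%E ->
  measurable [set w | exists i, B i w] /\
  (P [set w | exists i, B i w] <= (#|I|%:R * p)%:E)%E.
Proof.
move=> mB PB.
have h (s : seq I) : measurable [set w | exists2 i, i \in s & B i w] /\
    (P [set w | exists2 i, i \in s & B i w] <= ((size s)%:R * p)%:E)%E.
  elim: s => [|i s [m1 p1]].
    rewrite (_ : mkset _ = set0); last by apply/seteqP; split => // w [].
    by split => //; rewrite measure0 mul0r.
  have e : [set w | exists2 j, j \in i :: s & B j w] =
      B i `|` [set w | exists2 j, j \in s & B j w].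
    apply/seteqP; split => w /=.
      by move=> [j]; rewrite inE => /orP [/eqP ->|js] Bj; [left|right; exists j].
    by move=> [Bi|[j js Bj]]; [exists i => //; rewrite inE eqxx|exists j => //;
      rewrite inE js orbT].
  rewrite e; split; first exact: measurableU.
  apply: le_trans (measureU2 _ (mB i) m1) _.
  by rewrite /= -add1n natrD mulrDl mul1r EFinD; apply: leeD.
have -> : [set w | exists i, B i w] = [set w | exists2 i, i \in enum I & B i w].
  apply/seteqP; split => w; first by case=> i Bi; exists i => //; rewrite mem_enum.
  by case=> i _ Bi; exists i.
by rewrite cardE; exact: h.
Qed.

Definition noise_matrix (d L N : nat) (eta : nat -> R) (s : nat) : 'M[C]_d :=
  \matrix_(k < d, l < d) ((N%:R)^-1 * \sum_(j < N)
    (eta (2 * k * d + s * d + 2 * d ^ 2 * j + N + l.+1)%N)%:C%C * weyl_weight R L j).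

Lemma noise_level_sum (n s ell Vc Vs lam : R) :
  0 < n -> 0 < s -> 0 < ell -> 0 <= Vc -> 0 <= Vs -> Vc + Vs = n ->
  lam = Num.sqrt (2 * ell) / (s * Num.sqrt n) ->
  (lam * s ^+ 2 * Vc / 2 + ell / lam) ^+ 2 + (lam * s ^+ 2 * Vs / 2 + ell / lam) ^+ 2
    <= 5 / 2 * s ^+ 2 * ell * n.
Proof.
move=> n0 s0 ell0 Vc0 Vs0 hV hlam.
have sn0 : 0 < Num.sqrt n by rewrite sqrtr_gt0.
have lam0 : 0 < lam by rewrite hlam divr_gt0 ?mulr_gt0 // sqrtr_gt0 mulr_gt0.
have lam2 : lam ^+ 2 = 2 * ell / (s ^+ 2 * n).
  by rewrite hlam expr_div_n exprMn !sqr_sqrtr // ltW // mulr_gt0.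
have e V : (lam * s ^+ 2 * V / 2 + ell / lam) ^+ 2 =
    s ^+ 2 * ell * V ^+ 2 / (2 * n) + s ^+ 2 * V * ell + ell * s ^+ 2 * n / 2.
  have -> : (lam * s ^+ 2 * V / 2 + ell / lam) ^+ 2 =
      lam ^+ 2 * (s ^+ 4 * V ^+ 2 / 4) + s ^+ 2 * V * ell + ell ^+ 2 / lam ^+ 2.
    by field; rewrite gt_eqF.
  by rewrite lam2; field; rewrite !gt_eqF.
rewrite !e.
have -> : s ^+ 2 * ell * Vc ^+ 2 / (2 * n) + s ^+ 2 * Vc * ell + ell * s ^+ 2 * n / 2 +
  (s ^+ 2 * ell * Vs ^+ 2 / (2 * n) + s ^+ 2 * Vs * ell + ell * s ^+ 2 * n / 2) =
  s ^+ 2 * ell / (2 * n) * (Vc ^+ 2 + Vs ^+ 2) + s ^+ 2 * ell * (Vc + Vs) + s ^+ 2 * ell * n.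
  by field; rewrite gt_eqF.
rewrite hV.
have h : Vc ^+ 2 + Vs ^+ 2 <= n ^+ 2.
  by rewrite -hV sqrrD -addrA [_ *+ 2 + _]addrC addrA lerDl mulrn_wge0 // mulr_ge0.
have -> : 5 / 2 * s ^+ 2 * ell * n =
   s ^+ 2 * ell / (2 * n) * n ^+ 2 + s ^+ 2 * ell * n + s ^+ 2 * ell * n.
  by field; rewrite gt_eqF.
rewrite !lerD2r ler_wpM2l // divr_ge0 ?mulr_ge0 ?sqr_ge0 // ltW // mulr_gt0.
Qed.

Lemma weyl_weight_sum N L :
  \sum_(j < N) (complex.Re (weyl_weight R L j)) ^+ 2 +
  \sum_(j < N) (complex.Im (weyl_weight R L j)) ^+ 2 = N%:R.
Proof.
rewrite -big_split /= (eq_bigr (fun=> 1)) => [|j _]; last by rewrite /= cos2Dsin2.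
by rewrite sumr_const card_ord.
Qed.

Context {dO : measure_display} {Omega : measurableType dO}.
Variable P : probability Omega R.

Lemma noise_event (d L N : nat) (F : nat -> set (set Omega)) (sigma delta : R)
    (x : nat -> Omega -> 'cV[R]_d) (eta : nat -> Omega -> R) :
  (0 < d)%N -> (0 < N)%N -> 0 <= sigma -> cond_subgaussian P F sigma x eta ->
  0 < delta <= 1 ->
  exists E : set Omega, [/\ measurable E, ((1 - delta)%:E <= P E)%E &
    forall w, E w -> forall s : nat, (s < 2)%N ->
      frob (noise_matrix d L N (eta ^~ w) s) <=
        threshold d sigma delta N - (2 * Num.sqrt N%:R)^-1].
Proof.
move=> d0 N0 sg0 hsub /andP [de0 de1].
have d0R : (0 : R) < d%:R by rewrite ltr0n.
have n0 : (0 : R) < N%:R by rewrite ltr0n.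
pose q : R := 4 * d%:R ^+ 2 / delta.
have q4 : 4 <= q.
  rewrite /q ler_pdivlMr // -[leRHS]mulr1 -mulrA ler_pM2l // mulr1.
  by apply: le_trans de1 _; rewrite expr_ge1 // ler1n.
have q0 : 0 < q by apply: lt_le_trans q4.
pose Lam := ln q; pose ell := ln (2 * q).
have ln2 : 0 < ln 2 :> R by rewrite ln_gt0 // ltr1n.
have Lam2 : 2 * ln 2 <= Lam.
  have -> : 2 * ln 2 = ln 4 :> R.
    by rewrite mulr_natl -lnXn // expr2 -natrM.
  by rewrite /Lam ler_ln // posrE.
have Lam0 : 0 < Lam by apply: lt_le_trans Lam2; rewrite mulr_gt0.
have ellE : ell = ln 2 + Lam by rewrite /ell lnM ?posrE.
have ell0 : 0 < ell by rewrite ellE addr_gt0.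
have ellLam : ell <= 3 / 2 * Lam.
  by rewrite ellE; move: Lam2; clear; move: (ln 2) Lam => a b; lra.
pose sL := Num.sqrt Lam.
have sL0 : 0 < sL by rewrite sqrtr_gt0.
pose s' := sigma + (4 * d%:R * sL)^-1.
have s'0 : 0 < s' by rewrite ltr_wpDl // invr_gt0 !mulr_gt0.
have ss' : sigma <= s' by rewrite lerDl invr_ge0 !mulr_ge0 // ltW.
pose lam := Num.sqrt (2 * ell) / (s' * Num.sqrt N%:R).
have lam0 : 0 < lam by rewrite divr_gt0 ?mulr_gt0 // sqrtr_gt0 // mulr_gt0.
pose tt (s k l j : nat) := (2 * k * d + s * d + 2 * d ^ 2 * j + N + l.+1)%N.
have tt1 s k l j : (1 <= tt s k l j)%N by rewrite /tt addnS.
have ttm s k l i j : (i < j)%N -> (tt s k l i < tt s k l j)%N.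
  by move=> ij; rewrite /tt !ltn_add2r ltn_add2l ltn_pmul2l // muln_gt0 expn_gt0 d0.
pose I := ((bool * ('I_d * 'I_d)) * (bool * bool))%type.
pose a (c g : bool) (j : nat) : R :=
  (-1) ^+ g * (if c then complex.Re (weyl_weight R L j) else complex.Im (weyl_weight R L j)).
pose V (c : bool) : R := if c then \sum_(j < N) (complex.Re (weyl_weight R L j)) ^+ 2
  else \sum_(j < N) (complex.Im (weyl_weight R L j)) ^+ 2.
have Va c g : \sum_(j < N) a c g j ^+ 2 = V c.
  by rewrite /V; case: c; apply: eq_bigr => j _; rewrite /a exprMn sqrr_sign mul1r.
pose eps c := lam * s' ^+ 2 * V c / 2 + ell / lam.
pose S (i : I) w := \sum_(j < N) a i.2.1 i.2.2 j * eta (tt i.1.1 i.1.2.1 i.1.2.2 j) w.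
pose B (i : I) := [set w | eps i.2.1 <= S i w].
have mB i : measurable (B i).
  have := measurable_fun_ler (@measurable_cst _ _ Omega R setT (eps i.2.1))
    (noise_sum_measurable hsub (a i.2.1 i.2.2) N (tt1 i.1.1 i.1.2.1 i.1.2.2)).
  by move=> /(_ measurableT [set true] Logic.I); rewrite setTI.
have PB i : (P (B i) <= (expR (- ell))%:E)%E.
  rewrite /B /eps -(Va _ i.2.2).
  apply: (@noise_sum_tail _ _ _ P _ _ _ _ _ hsub (a i.2.1 i.2.2)
    (tt i.1.1 i.1.2.1 i.1.2.2) N lam s' ell (tt1 _ _ _) _ lam0).
    by move=> i' j; exact: ttm.
  by rewrite sg0 ss'.
have [mU PU] := union_bound mB PB.
exists (~` [set w | exists i, B i w]); split.
- exact: measurableC.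
- rewrite probability_setC // EFinB leeB // (le_trans PU) // lee_fin.
  rewrite !card_prod !card_ord card_bool expRN lnK; last by rewrite posrE mulr_gt0.
  have -> : (2 * (d * d) * (2 * 2))%:R = 8 * d%:R ^+ 2 :> R by rewrite !natrM; ring.
  by rewrite /q le_eqVlt; apply/orP; left; apply/eqP; field; rewrite !gt_eqF.
move=> w hw s s2.
have hS c (k l : 'I_d) : `|\sum_(j < N) (if c then complex.Re (weyl_weight R L j) else
  complex.Im (weyl_weight R L j)) * eta (tt s k l j) w| <= eps c.
  have hb g : S ((s == 1%N, (k, l)), (c, g)) w < eps c.
    rewrite ltNge; apply/negP => h; apply: hw.
    by exists ((s == 1%N, (k, l)), (c, g)).
  have sb : (s == 1%N) = s :> nat by case: s s2 {hb} => [|[|]].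
  rewrite ler_norml; apply/andP; split.
    rewrite lerNl; apply: ltW; apply: le_lt_trans (hb true).
    rewrite /S /= sb -sumrN le_eqVlt; apply/orP; left; apply/eqP.
    by apply: eq_bigr => j _; rewrite /a expr1 mulN1r mulNr.
  apply: ltW; apply: le_lt_trans (hb false).
  rewrite /S /= sb le_eqVlt; apply/orP; left; apply/eqP.
  by apply: eq_bigr => j _; rewrite /a expr0 mul1r.
have V0 c : 0 <= V c by rewrite /V; case: c; apply: sumr_ge0 => j _; exact: sqr_ge0.
have hent (k l : 'I_d) : Normc.normc (noise_matrix d L N (eta ^~ w) s k l) ^+ 2 <=
    4 * s' ^+ 2 * Lam / N%:R.
  rewrite mxE normc_mul.
  have -> : ((N%:R)^-1 : C) = ((N%:R)^-1 : R)%:C%C by rewrite rmorphV ?unitfE ?gt_eqF // rmorph_nat.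
  rewrite normc_real ger0_norm ?invr_ge0 ?ler0n // exprMn normc_sqr.
  rewrite !raddf_sum.
  have -> : \sum_(j < N) complex.Re ((eta (tt s k l j) w)%:C%C * weyl_weight R L j) =
    \sum_(j < N) complex.Re (weyl_weight R L j) * eta (tt s k l j) w.
    by apply: eq_bigr => j _; rewrite /= mul0r subr0 mulrC.
  have -> : \sum_(j < N) complex.Im ((eta (tt s k l j) w)%:C%C * weyl_weight R L j) =
    \sum_(j < N) complex.Im (weyl_weight R L j) * eta (tt s k l j) w.
    by apply: eq_bigr => j _; rewrite /= mul0r addr0 mulrC.
  have h1 c (y : R) : `|y| <= eps c -> y ^+ 2 <= eps c ^+ 2.
    move=> h; rewrite -[y ^+ 2]real_normK ?num_real // ler_pXn2r ?nnegrE //.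
    exact: le_trans h.
  have h2 := lerD (h1 _ _ (hS true k l)) (h1 _ _ (hS false k l)).
  have h3 := noise_level_sum n0 s'0 ell0 (V0 true) (V0 false) (weyl_weight_sum N L) erefl.
  have h4 := le_trans h2 h3.
  rewrite -ler_pdivlMl ?exprn_gt0 ?invr_gt0 //; apply: le_trans h4 _.
  have -> : ((N%:R : R)^-1 ^+ 2)^-1 * (4 * s' ^+ 2 * Lam / N%:R) = 4 * s' ^+ 2 * Lam * N%:R.
    by field; rewrite gt_eqF.
  rewrite ler_pM2r //.
  have : 5 / 2 * s' ^+ 2 * ell <= 5 / 2 * s' ^+ 2 * (3 / 2 * Lam).
    by rewrite ler_wpM2l // mulr_ge0 ?sqr_ge0.
  move=> h; apply: le_trans h _.
  have -> : 5 / 2 * s' ^+ 2 * (3 / 2 * Lam) = 15 / 4 * (s' ^+ 2 * Lam) by field.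
  rewrite -[leRHS]mulrA ler_wpM2r ?mulr_ge0 ?(ltW s'0) ?(ltW Lam0) //.
  by rewrite ler_pdivrMr // -natrM ler_nat.
have thE : threshold d sigma delta N - (2 * Num.sqrt N%:R)^-1 =
    2 * d%:R * s' * sL / Num.sqrt N%:R.
  rewrite /threshold -/q -/Lam.
  have -> : Num.sqrt (4 * d%:R ^+ 2 * sigma ^+ 2 * Lam) = 2 * d%:R * sigma * sL.
    have -> : 4 * d%:R ^+ 2 * sigma ^+ 2 * Lam = (2 * d%:R * sigma) ^+ 2 * Lam by ring.
    by rewrite sqrtrM ?sqr_ge0 // sqrtr_sqr ger0_norm // !mulr_ge0 ?ler0n.
  by rewrite /s'; field; rewrite !gt_eqF // sqrtr_gt0.
rewrite thE; apply: frob_le.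
  by rewrite divr_ge0 // !mulr_ge0 // ltW.
apply: (@le_trans _ _ (\sum_(k < d) \sum_(l < d) (4 * s' ^+ 2 * Lam / N%:R))).
  by apply: ler_sum => k _; apply: ler_sum => l _; exact: hent.
rewrite !sumr_const !card_ord.
have -> (X : R) : X *+ d *+ d = X * d%:R ^+ 2 by rewrite -[LHS]mulr_natr -[X *+ d]mulr_natr
  expr2 mulrA.
rewrite expr_div_n !exprMn !sqr_sqrtr ?ler0n ?(ltW Lam0) //.
by rewrite le_eqVlt; apply/orP; left; apply/eqP; ring.
Qed.

End noise_event.

(** * Bounded orbits *)

Section poly_action.
Variable R : realType.
Local Notation C := R[i].
Variables (n : nat) (A : 'M[C]_n.+1).

Definition act (p : {poly C}) (v : 'cV[C]_n.+1) : 'cV[C]_n.+1 := horner_mx A p *m v.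

Lemma act1 v : act 1 v = v.
Proof. by rewrite /act rmorph1 mul1mx. Qed.

Lemma actM p q v : act (p * q) v = act p (act q v).
Proof. by rewrite /act rmorphM /= mulmxA. Qed.

Lemma actD p q v : act (p + q) v = act p v + act q v.
Proof. by rewrite /act rmorphD mulmxDl. Qed.

Lemma act_sum (I : Type) (s : seq I) (P : pred I) p (f : I -> 'cV[C]_n.+1) :
  act p (\sum_(i <- s | P i) f i) = \sum_(i <- s | P i) act p (f i).
Proof. by rewrite /act mulmx_sumr. Qed.

Lemma act0 p : act p 0 = 0.
Proof. by rewrite /act mulmx0. Qed.

Lemma actXsubC a v : act ('X - a%:P) v = A *m v - a *: v.
Proof. by rewrite /act rmorphB /= horner_mx_X horner_mx_C mulmxBl mul_scalar_mx. Qed.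

Lemma actXn k v : act 'X^k v = A ^+ k *m v.
Proof. by rewrite /act rmorphXn /= horner_mx_X. Qed.

Lemma actC p q v : act p (act q v) = act q (act p v).
Proof. by rewrite -!actM mulrC. Qed.

Lemma act_dvd p q v : p %| q -> act p v = 0 -> act q v = 0.
Proof. by move=> /dvdpP [r ->] h; rewrite actM h act0. Qed.

Lemma act_coprime p q v : coprimep p q -> act p v = 0 -> act q v = 0 -> v = 0.
Proof.
move=> /Bezout_eq1_coprimepP [[u w] /= h] hp hq.
by rewrite -[v]act1 -h actD !actM hp hq !act0 addr0.
Qed.

Lemma coprime_root_prod (a : C) (s : seq C) (m : C -> nat) k : a \notin s ->
  coprimep (('X - a%:P) ^+ k) (\prod_(b <- s) ('X - b%:P) ^+ m b).
Proof.
move=> as_; apply: coprimep_expl; rewrite big_seq_cond.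
elim/big_ind: _ => [|p q hp hq|b /andP [bs _]]; first exact: coprimep1.
  by rewrite coprimepMr hp hq.
apply: coprimep_expr; apply: coprimep_XsubC2.
by rewrite subr_eq0; apply: contraNneq as_ => <-.
Qed.

Lemma act_decomposition (s : seq C) (m : C -> nat) v : uniq s ->
  act (\prod_(a <- s) ('X - a%:P) ^+ m a) v = 0 ->
  exists p : C -> {poly C}, v = \sum_(a <- s) act (p a) v /\
    forall a, a \in s -> act (('X - a%:P) ^+ m a) (act (p a) v) = 0.
Proof.
elim: s v => [|a s IH] v /=.
  rewrite big_nil act1 => _ ->; exists (fun=> 0); rewrite big_nil.
  by split.
move=> /andP [as_ us]; rewrite big_cons => hv.
set q := \prod_(b <- s) _ in hv.
have /Bezout_eq1_coprimepP [[u w] /= h] : coprimep (('X - a%:P) ^+ m a) q.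
  exact: coprime_root_prod.
pose r := u * ('X - a%:P) ^+ m a.
have [|p [hp1 hp2]] := IH (act r v) us.
  by rewrite -/q /r -actM mulrCA actM [q * _]mulrC hv act0.
exists (fun b => if b == a then w * q else p b * r); split.
  rewrite big_cons eqxx -[LHS]act1 -h actD addrC; congr (_ + _).
  rewrite -/r [LHS]hp1 big_seq [RHS]big_seq; apply: eq_bigr => b bs.
  by rewrite -actM; case: eqP bs as_ => [->|//] ->.
move=> b; rewrite inE; case: eqP => [->|_] /= bs.
  by rewrite -actM mulrCA actM hv act0.
by rewrite [act (_ * r) v]actM hp2.
Qed.

Lemma act_independent (s : seq C) (m : C -> nat) (f : C -> 'cV[C]_n.+1) : uniq s ->
  (forall a, a \in s -> act (('X - a%:P) ^+ m a) (f a) = 0) ->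
  \sum_(a <- s) f a = 0 -> forall a, a \in s -> f a = 0.
Proof.
move=> us hf hs a ais.
pose q := \prod_(b <- rem a s) ('X - b%:P) ^+ m b.
have hq b : b \in s -> b != a -> act q (f b) = 0.
  move=> bs ba; apply: (act_dvd _ (hf b bs)).
  rewrite /q (big_rem b) /=; first exact: dvdp_mulr.
  by rewrite mem_rem_uniq // inE ba.
apply: (@act_coprime (('X - a%:P) ^+ m a) q); last 2 first.
- exact: hf.
- have := congr1 (act q) hs; rewrite act_sum act0 (big_rem a) //= big_seq big1 ?addr0 //.
  move=> b; rewrite mem_rem_uniq // inE => /andP [ba bs].
  exact: hq.
by apply: coprime_root_prod; rewrite mem_rem_uniq // inE eqxx.
Qed.

Lemma generalized_eigen_decomposition v :
  exists (s : seq C) (p : C -> {poly C}), [/\ uniq s, v = \sum_(a <- s) act (p a) v &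
    forall a, a \in s -> act (('X - a%:P) ^+ n.+1) (act (p a) v) = 0].
Proof.
have [rs hrs] := closed_field_poly_normal (char_poly A).
rewrite (monicP (char_poly_monic A)) scale1r in hrs.
have [||p [h1 h2]] := @act_decomposition (undup rs) (fun a => count_mem a rs) v.
- exact: undup_uniq.
- by rewrite prodr_undup_exp_count -hrs /act Cayley_Hamilton mul0mx.
exists (undup rs), p; split; [exact: undup_uniq|exact: h1|] => a ars.
apply: act_dvd (h2 a ars); apply: dvdp_exp2l.
have : size rs = n.+1.
  by have := size_char_poly A; rewrite hrs size_prod_XsubC => -[].
by move=> <-; exact: count_size.
Qed.

End poly_action.

Section bounded_orbits.
Variable R : realType.
Local Notation C := R[i].
Local Notation normc := (@Normc.normc R).
Variables (n : nat) (A : 'M[C]_n.+1).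

Definition bounded_orbit (v : 'cV[C]_n.+1) := exists B : R, forall t, frob (A ^+ t *m v) <= B.

Lemma frobZ m k (c : C) (v : 'M[C]_(m, k)) : frob (c *: v) = normc c * frob v.
Proof.
rewrite /frob; have -> : frob2 (c *: v) = normc c ^+ 2 * frob2 v.
  rewrite /frob2 mulr_sumr; apply: eq_bigr => i _; rewrite mulr_sumr.
  by apply: eq_bigr => j _; rewrite mxE normc_mul exprMn.
by rewrite sqrtrM ?sqr_ge0 // sqrtr_sqr ger0_norm // normc_ge0.
Qed.

Lemma bounded_orbit_act p v : bounded_orbit v -> bounded_orbit (act A p v).
Proof.
move=> [B hB]; exists (frob (horner_mx A p) * B) => t.
rewrite -actXn actC actXn; apply: le_trans (frobM _ _) _.
by rewrite ler_wpM2l ?frob_ge0.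
Qed.

Lemma eigen_iter a (v : 'cV[C]_n.+1) t : A *m v = a *: v -> A ^+ t *m v = a ^+ t *: v.
Proof.
move=> h; elim: t => [|t IH]; first by rewrite !expr0 mul1mx scale1r.
by rewrite exprSr -mulmxE -mulmxA h -scalemxAr IH scalerA exprS.
Qed.

Lemma bernoulli (x : R) t : 0 <= x -> 1 + t%:R * x <= (1 + x) ^+ t.
Proof.
move=> x0; elim: t => [|t IH]; first by rewrite mul0r addr0 expr0.
rewrite exprS; apply: (@le_trans _ _ ((1 + x) * (1 + t%:R * x))).
  rewrite -natr1 -subr_ge0.
  have -> : (1 + x) * (1 + t%:R * x) - (1 + (t%:R + 1) * x) = t%:R * x ^+ 2 by ring.
  by rewrite mulr_ge0 ?sqr_ge0.
by rewrite ler_wpM2l // addr_ge0.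
Qed.

Lemma linear_unbounded (x y B : R) : 0 < x -> ~ (forall t : nat, t%:R * x <= y).
Proof.
move=> x0 h; have := h (Num.truncn (`|y| / x)).+1.
rewrite leNgt => /negP; apply; apply: le_lt_trans (ler_norm y) _.
by rewrite -ltr_pdivrMr // truncnS_gt.
Qed.

Lemma act_XsubC_expS m a v : act A (('X - a%:P) ^+ m.+1) v = 0 ->
  act A (('X - a%:P) ^+ m) (act A ('X - a%:P) v) = 0.
Proof. by rewrite -actM -exprSr. Qed.

Lemma act_eigen a v : act A ('X - a%:P) v = 0 -> A *m v = a *: v.
Proof. by rewrite actXsubC => /subr0_eq. Qed.

Lemma bounded_gt1 m a v : 1 < normc a -> act A (('X - a%:P) ^+ m) v = 0 ->
  bounded_orbit v -> v = 0.
Proof.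
move=> a1; elim: m v => [|m IH] v; first by rewrite expr0 act1.
move=> /act_XsubC_expS hv bv.
have /act_eigen e := IH _ hv (bounded_orbit_act _ bv).
case: bv => B hB; apply: frob_eq0; apply/eqP; rewrite eq_le frob_ge0 andbT leNgt.
apply/negP => v0.
apply: (@linear_unbounded ((normc a - 1) * frob v) B B) => [|t].
  by rewrite mulr_gt0 // subr_gt0.
apply: le_trans (hB t); rewrite (eigen_iter _ e) frobZ normcX mulrA ler_wpM2r ?frob_ge0 //.
have := @bernoulli (normc a - 1) t; rewrite subr_ge0 => /(_ (ltW a1)).
by rewrite [1 + (normc a - 1)]addrC subrK; apply: le_trans; rewrite lerDr.
Qed.

Lemma bounded_eq1 m a v : normc a = 1 -> act A (('X - a%:P) ^+ m) v = 0 ->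
  bounded_orbit v -> A *m v = a *: v.
Proof.
move=> a1; elim: m v => [|m IH] v.
  by rewrite expr0 act1 => ->; rewrite mulmx0 scaler0.
move=> /act_XsubC_expS hv bv; set g := act A _ v in hv.
have e : A *m g = a *: g := IH _ hv (bounded_orbit_act _ bv).
have a0 : a != 0 by rewrite -normc_eq0 a1 oner_eq0.
have hAv : A *m v = a *: v + g by rewrite /g actXsubC addrC subrK.
have it t : A ^+ t *m v = a ^+ t *: (v + (t%:R / a) *: g).
  elim: t => [|t IHt]; first by rewrite !expr0 mul1mx mul0r scale0r addr0 scale1r.
  rewrite exprS -mulmxE -mulmxA IHt -scalemxAr mulmxDr hAv -scalemxAr e exprSr.
  rewrite -[RHS]scalerA; congr (_ *: _).
  rewrite scalerDr !scalerA -addrA; congr (_ + _).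
  rewrite -[X in X + _]scale1r -scalerDl; congr (_ *: _).
  by rewrite -natr1; field.
suff g0 : g = 0 by apply: act_eigen.
case: bv => B hB; apply: frob_eq0; apply/eqP; rewrite eq_le frob_ge0 andbT leNgt.
apply/negP => g0; apply: (@linear_unbounded (frob g) (B + frob v) B) => // t.
have h := hB t; rewrite it frobZ normcX a1 expr1n mul1r in h.
have -> : t%:R * frob g = frob ((t%:R / a) *: g).
  by rewrite frobZ normc_mul normc_inv a1 invr1 mulr1 -(rmorph_nat (real_complex R))
    normc_real ger0_norm.
have -> : (t%:R / a) *: g = (v + (t%:R / a) *: g) - v by rewrite addrC addKr.
by apply: le_trans (frobB _ _) _; rewrite lerD2r.
Qed.

Lemma lt1_decay m a v : normc a < 1 -> act A (('X - a%:P) ^+ m) v = 0 ->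
  forall tau, normc a < tau -> exists K, 0 <= K /\
  forall t, frob (A ^+ t *m v) <= K * tau ^+ t.
Proof.
move=> a1 + tau atau; have tau0 : 0 < tau := le_lt_trans (normc_ge0 a) atau.
elim: m v => [|m IH] v.
  rewrite expr0 act1 => ->; exists 0; split => // t.
  by rewrite mulmx0 mul0r -(scale0r (0 : 'cV[C]_n.+1)) frobZ Normc.normc0 mul0r.
move=> /act_XsubC_expS /IH [K [K0 hK]]; set g := act A _ v in hK.
have d0 : 0 < tau - normc a by rewrite subr_gt0.
have hAv : A *m v = a *: v + g by rewrite /g actXsubC addrC subrK.
exists (frob v + K / (tau - normc a)); split.
  by rewrite addr_ge0 ?frob_ge0 // divr_ge0 // ltW.
set K' := _ + _; elim=> [|t IHt].
  by rewrite !expr0 mul1mx mulr1 lerDl divr_ge0 // ltW.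
rewrite exprSr -mulmxE -mulmxA hAv mulmxDr -scalemxAr.
apply: le_trans (frobD _ _) _; rewrite frobZ.
apply: (@le_trans _ _ (normc a * (K' * tau ^+ t) + K * tau ^+ t)).
  by apply: lerD; [rewrite ler_wpM2l ?normc_ge0|exact: hK].
rewrite mulrA -mulrDl exprS mulrA ler_wpM2r ?exprn_ge0 ?(ltW tau0) //.
rewrite -lerBrDl [K' * tau]mulrC -mulrBl /K' mulrDr mulrCA mulfV ?gt_eqF // mulr1.
by rewrite lerDr mulr_ge0 ?frob_ge0 // ltW.
Qed.

End bounded_orbits.

Section orbit_decomposition.
Variable R : realType.
Local Notation C := R[i].
Local Notation normc := (@Normc.normc R).

Lemma act_orbit_span n (A : 'M[C]_n.+1) (v : 'cV[C]_n.+1) p b :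
  b != 0 -> A *m act A p v = b *: act A p v -> orbit_span A v (act A p v).
Proof.
move=> b0 h; exists (size p), (fun j => b^-1 * p`_j).
have -> : act A p v = b^-1 *: (A *m act A p v) by rewrite h scalerA mulVf // scale1r.
have -> : act A p v = \sum_(j < size p) p`_j *: (A ^+ j *m v).
  rewrite /act -{1}[p]coefK poly_def rmorph_sum mulmx_suml; apply: eq_bigr => j _.
  by rewrite -mul_polyC rmorphM /= horner_mx_C -mulmxE mul_scalar_mx rmorphXn /=
    horner_mx_X -scalemxAl.
rewrite mulmx_sumr scaler_sumr; apply: eq_bigr => j _.
by rewrite -scalemxAr scalerA exprS -mulmxE mulmxA.
Qed.

Lemma gen_eigen_component_exp n (A : 'M[C]_n.+1) (v : 'cV[C]_n.+1) (s : seq C)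
    (f : C -> 'cV[C]_n.+1) k b :
  uniq s -> v = \sum_(a <- s) f a ->
  (forall a, a \in s -> act A (('X - a%:P) ^+ n.+1) (f a) = 0) ->
  b \in s -> f b != 0 ->
  exists2 w, gen_eigen_component (A ^+ k) v (b ^+ k) w & w != 0.
Proof.
move=> us hv hf bs fb0.
pose g c := \sum_(a <- s | a ^+ k == c) f a.
exists (g (b ^+ k)); last first.
  rewrite /g -big_filter; apply: contra fb0 => /eqP h; apply/eqP.
  apply: (act_independent (A := A) (filter_uniq _ us) (m := fun=> n.+1) _ h) => [a|].
    by rewrite mem_filter => /andP [_ /hf].
  by rewrite mem_filter eqxx.
exists (undup [seq a ^+ k | a <- s]), g; split => //.
- by split; [exact: undup_uniq|rewrite mem_undup; apply: map_f].
- move=> c; rewrite /g mulmx_sumr big_seq_cond big1 // => a /andP [ais /eqP <-].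
  have dv : ('X - a%:P) ^+ n.+1 %| ('X^k - (a ^+ k)%:P : {poly C}) ^+ n.+1.
    by apply: dvdp_exp2r; rewrite polyC_exp subrXX; exact: dvdp_mulr.
  have := act_dvd dv (hf a ais).
  by rewrite /act rmorphXn rmorphB /= rmorphXn /= horner_mx_X horner_mx_C.
- rewrite /g (exchange_big_dep predT) //= hv big_seq [RHS]big_seq; apply: eq_bigr => a ais.
  rewrite big_mkcond (bigD1_seq (a ^+ k)) ?undup_uniq ?mem_undup //=; last exact: map_f.
  by rewrite eqxx big1 ?addr0 // => c; rewrite eq_sym => /negbTE ->.
Qed.

Lemma exists_tau (s : seq C) :
  exists tau : R, 0 <= tau < 1 /\ forall a, a \in s -> normc a < 1 -> normc a < tau.
Proof.
elim: s => [|a s [tau [/andP [t0 t1] h]]]; first by exists 0; rewrite lexx ltr01.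
case: (ltP (normc a) 1) => ha; last first.
  exists tau; rewrite t0 t1; split => // b; rewrite inE => /orP [/eqP ->|]; last exact: h.
  by rewrite ltNge ha.
exists (Num.max tau ((1 + normc a) / 2)).
have a2 : normc a < (1 + normc a) / 2 < 1 
  by move: ha; clear; move: (normc a) => y hy; apply/andP; split; lra.
case/andP: a2 => a2 a3; rewrite le_max t0 gt_max t1 a3; split => // b.
rewrite inE lt_max => /orP [/eqP ->|bs] hb; first by rewrite a2 orbT.
by rewrite h.
Qed.

Lemma orbit_decomposition n (A : 'M[C]_n.+1) (v : 'cV[C]_n.+1) :
  bounded_orbit A v ->
  exists (bs : seq C) (u : C -> 'cV[C]_n.+1) (K tau : R),
  [/\ uniq bs /\ 0 <= K, 0 <= tau < 1,
    forall b, b \in bs -> [/\ normc b = 1, A *m u b = b *: u b & u b != 0],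
    forall t, frob (A ^+ t *m v - \sum_(b <- bs) b ^+ t *: u b) <= K * tau ^+ t &
    forall b, b \in bs -> orbit_span A v (u b) /\
      forall k, exists2 w, gen_eigen_component (A ^+ k) v (b ^+ k) w & w != 0].
Proof.
move=> bv; have [s [p [us hv hp]]] := generalized_eigen_decomposition A v.
pose f a := act A (p a) v; pose Q a := (normc a == 1) && (f a != 0).
have bf a : bounded_orbit A (f a) by exact: bounded_orbit_act.
have [tau [tau01 htau]] := exists_tau s.
have decay (s' : seq C) : {subset s' <= s} -> exists K : R, 0 <= K /\
    forall t, frob (\sum_(a <- s' | ~~ Q a) A ^+ t *m f a) <= K * tau ^+ t.
  elim: s' => [_|a s' IH hs'].
    exists 0; split => // t; rewrite big_nil mul0r.
    by rewrite -(scale0r (0 : 'cV[C]_n.+1)) frobZ Normc.normc0 mul0r.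
  have [K [K0 hK]] := IH (fun x hx => hs' x (mem_behead (s := a :: s') hx)).
  have ais : a \in s by apply: hs'; rewrite inE eqxx.
  case: (boolP (Q a)) => Qa.
    by exists K; split => // t; rewrite big_cons Qa; exact: hK.
  have [K' [K'0 hK']] : exists K' : R, 0 <= K' /\ forall t, frob (A ^+ t *m f a) <= K' * tau ^+ t.
    case: (ltgtP (normc a) 1) => a1.
    - exact: (lt1_decay a1 (hp a ais) (htau a ais a1)).
    - have fa0 : f a = 0 := bounded_gt1 a1 (hp a ais) (bf a).
      exists 0; split => // t; rewrite fa0 mulmx0 mul0r.
      by rewrite -(scale0r (0 : 'cV[C]_n.+1)) frobZ Normc.normc0 mul0r.
    - move: Qa; rewrite /Q a1 eqxx /= negbK => /eqP fa0.
      exists 0; split => // t; rewrite fa0 mulmx0 mul0r.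
      by rewrite -(scale0r (0 : 'cV[C]_n.+1)) frobZ Normc.normc0 mul0r.
  exists (K' + K); split; first exact: addr_ge0.
  move=> t; rewrite big_cons; case: ifP => [_|/negP nQa]; last by case: nQa; apply/negP.
  have := lerD (hK' t) (hK t); rewrite -(mulrDl K' K).
  by apply: le_trans; exact: frobD.
have [K [K0 hK]] := decay s (fun _ h => h).
exists [seq a <- s | Q a], f, K, tau; split => //.
- by split => //; exact: filter_uniq.
- move=> b; rewrite mem_filter => /andP [/andP [/eqP b1 fb0] bs]; split => //.
  exact: (bounded_eq1 b1 (hp b bs) (bf b)).
- move=> t; rewrite big_filter.
  have -> : A ^+ t *m v - \sum_(b <- s | Q b) b ^+ t *: f b =
      \sum_(a <- s | ~~ Q a) A ^+ t *m f a; last exact: hK.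
  rewrite {1}hv mulmx_sumr (bigID Q) /= addrAC.
  rewrite [X in X - _]big_seq_cond [X in _ - X]big_seq_cond.
  rewrite (eq_bigr (fun a => a ^+ t *: f a)) ?subrr ?add0r // => a /andP [ais /andP [/eqP a1 _]].
  exact/eigen_iter/(bounded_eq1 a1 (hp a ais) (bf a)).
- move=> b; rewrite mem_filter => /andP [/andP [/eqP b1 fb0] bs].
  have b0 : b != 0 by rewrite -normc_eq0 b1 oner_eq0.
  split; first by apply: (act_orbit_span b0); exact: (bounded_eq1 b1 (hp b bs) (bf b)).
  by move=> k; apply: (gen_eigen_component_exp k us hv hp bs fb0).
Qed.

Lemma eigenvectors_independent n (A : 'M[C]_n.+1) (bs : seq C) (u : C -> 'cV[C]_n.+1) (c : C -> C) :
  uniq bs -> (forall b, b \in bs -> A *m u b = b *: u b /\ u b != 0) ->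
  \sum_(b <- bs) c b *: u b = 0 -> forall b, b \in bs -> c b = 0.
Proof.
move=> ubs hu hs b bbs.
have := act_independent (A := A) ubs (m := fun=> 1%N) _ hs bbs.
have [hb ub0] := hu b bbs.
have h : forall a, a \in bs -> act A (('X - a%:P) ^+ 1) (c a *: u a) = 0.
  by move=> a /hu [ha _]; rewrite expr1 actXsubC -scalemxAr ha !scalerA mulrC subrr.
by move=> /(_ h) /eqP; rewrite scaler_eq0 (negbTE ub0) orbF => /eqP.
Qed.

End orbit_decomposition.

(** * Weyl averages and the data matrices *)

Section weyl_average.
Variable R : realType.
Local Notation C := R[i].
Local Notation normc := (@Normc.normc R).

Lemma periodic_bounded (f : nat -> R) p : (0 < p)%N -> (forall m, 0 <= f m) ->
  (forall m, f (m + p)%N = f m) -> forall N, f N <= \sum_(m < p) f m.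
Proof.
move=> p0 f0 fp N.
have h q m : f (q * p + m)%N = f m.
  elim: q => [|q IH]; first by rewrite mul0n.
  by rewrite mulSn -addnA addnC fp.
rewrite (divn_eq N p) h (bigD1 (Ordinal (ltn_pmod N p0))) //= lerDl.
by apply: sumr_ge0 => m _.
Qed.

Lemma twisted_periodic_average (a : nat -> C) p (zeta : C) :
  (0 < p)%N -> normc zeta = 1 -> (forall j, a (j + p)%N = zeta * a j) ->
  exists (c : C) (K : R), 0 <= K /\
    forall N, normc (\sum_(j < N) a j - N%:R * c) <= K.
Proof.
move=> p0 z1 ha; pose S N := \sum_(j < N) a j.
have Sp N : S (N + p)%N = S p + zeta * S N.
  rewrite /S addnC big_split_ord /= mulr_sumr; congr (_ + _).
  by apply: eq_bigr => j _; rewrite addnC ha.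
have fin (U : nat -> C) : (forall N, normc (U (N + p)%N) = normc (U N)) ->
    exists K : R, 0 <= K /\ forall N, normc (U N) <= K.
  move=> hU; exists (\sum_(m < p) normc (U m)).
  split; first by apply: sumr_ge0 => m _; exact: normc_ge0.
  by apply: (periodic_bounded p0) => // m; exact: normc_ge0.
have pC : (p%:R : C) != 0 by rewrite pnatr_eq0 -lt0n.
case: (eqVneq zeta 1) => [e|zn1].
  have [|K [K0 hK]] := fin (fun N => S N - N%:R * (S p / p%:R)).
    by move=> N; congr normc; rewrite Sp e natrD; field.
  by exists (S p / p%:R), K.
have z0 : 1 - zeta != 0 by rewrite subr_eq0 eq_sym.
have [|K [K0 hK]] := fin (fun N => S N - S p / (1 - zeta)).
  move=> N; have -> : S (N + p)%N - S p / (1 - zeta) = zeta * (S N - S p / (1 - zeta)).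
    by rewrite Sp; field.
  by rewrite normc_mul z1 mul1r.
exists 0, (K + normc (S p / (1 - zeta))); split; first by rewrite addr_ge0 ?normc_ge0.
move=> N; rewrite mulr0 subr0 -/(S N) -[S N](subrK (S p / (1 - zeta))).
by apply: le_trans (normcD_le _ _) _; rewrite lerD2r.
Qed.

Lemma cos_add_2pi (x : R) k : cos (x + k%:R * (2 * pi)) = cos x.
Proof.
elim: k => [|k IH]; first by rewrite mul0r addr0.
by rewrite -natr1 mulrDl mul1r addrA cosD IH [2 * pi]mulr_natl cos2pi sin2pi mulr1 mulr0 subr0.
Qed.

Lemma sin_add_2pi (x : R) k : sin (x + k%:R * (2 * pi)) = sin x.
Proof.
elim: k => [|k IH]; first by rewrite mul0r addr0.
by rewrite -natr1 mulrDl mul1r addrA sinD IH [2 * pi]mulr_natl cos2pi sin2pi mulr1 mulr0 addr0.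
Qed.

Lemma weyl_weight_period L j : (0 < L)%N ->
  weyl_weight R L (j + 2 * L)%N = weyl_weight R L j.
Proof.
move=> L0; rewrite /weyl_weight.
have L0R : (L%:R : R) != 0 by rewrite pnatr_eq0 -lt0n.
have -> : 2 * pi * ((j + 2 * L) ^ 2)%N%:R / (4 * L)%N%:R =
    2 * pi * (j ^ 2)%N%:R / (4 * L)%N%:R + (j + L)%N%:R * (2 * pi) :> R.
  by rewrite (natrX _ (j + 2 * L)) (natrX _ j) (natrM _ 4) (natrD _ j L) (natrD _ j (2 *
    L)) (natrM _ 2); field.
by rewrite cos_add_2pi sin_add_2pi.
Qed.

Lemma normc_weyl L j : normc (weyl_weight R L j) = 1.
Proof. by rewrite /weyl_weight /Normc.normc cos2Dsin2 sqrtr1. Qed.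

Lemma weyl_average L (z : C) : (0 < L)%N -> normc z = 1 ->
  exists (c : C) (K : R), 0 <= K /\
    forall N, normc (\sum_(j < N) z ^+ j * weyl_weight R L j - N%:R * c) <= K.
Proof.
move=> L0 z1; apply: (@twisted_periodic_average (fun j => z ^+ j * weyl_weight R L j) (2 *
  L)%N (z ^+ (2 * L)%N)).
- by rewrite muln_gt0.
- by rewrite normcX z1 expr1n.
- by move=> j; rewrite weyl_weight_period // exprD; ring.
Qed.

Lemma geometric_le_inv (tau : R) : 0 <= tau < 1 ->
  exists K : R, 0 <= K /\ forall N, N%:R * tau ^+ N <= K.
Proof.
case/andP=> t0 t1; case: (eqVneq tau 0) => [->|tn0].
  exists 0; split => // -[|N]; first by rewrite mul0r.
  by rewrite expr0n mulr0.
have tp : 0 < tau by rewrite lt_neqAle eq_sym tn0.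
have x0 : 0 < tau^-1 - 1 by rewrite subr_gt0 invf_gt1.
exists (tau^-1 - 1)^-1; split; first by rewrite invr_ge0 ltW.
move=> N; rewrite -[leRHS]mul1r ler_pdivlMr // mulrAC -ler_pdivlMr ?exprn_gt0 //.
have := bernoulli N (ltW x0).
rewrite [1 + (tau^-1 - 1)]addrC subrK exprVn div1r; apply: le_trans.
by rewrite lerDr.
Qed.

End weyl_average.

Section data_matrix.
Variable R : realType.
Local Notation C := R[i].
Local Notation normc := (@Normc.normc R).

Lemma dotcD d (u1 u2 : 'cV[C]_d) (x : 'cV[R]_d) : dotc (u1 + u2) x = dotc u1 x + dotc u2 x.
Proof. by rewrite /dotc -big_split; apply: eq_bigr => i _; rewrite mxE mulrDl. Qed.

Lemma normc_dotc d (u : 'cV[C]_d) (x : 'cV[R]_d) :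
  normc (dotc u x) <= frob u * \sum_i `|x i 0|.
Proof.
apply: le_trans (normc_sum _ _ _) _; rewrite mulr_sumr; apply: ler_sum => i _.
by rewrite normc_mul normc_real ler_wpM2r // frob_entry.
Qed.

Variables (n : nat) (M : 'M[R]_n.+1) (theta : 'cV[R]_n.+1) (L : nat).
Local Notation d := n.+1.
Local Notation A := (cmx M).
Local Notation v := (cmx theta).

Lemma cmx_orbit t : cmx (M ^+ t *m theta) = A ^+ t *m v.
Proof.
rewrite /cmx map_mxM; congr (_ *m _); elim: t => [|t IH].
  by rewrite !expr0 map_mx1.
by rewrite !exprS -!mulmxE map_mxM IH.
Qed.

Lemma frob_cmx k (x : 'cV[R]_k) : frob (cmx x) = vnorm x.
Proof.
congr Num.sqrt; apply: eq_bigr => i _; rewrite big_ord1 mxE normc_real.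
by rewrite real_normK ?num_real.
Qed.

Lemma bounded_orbit_cmx (B : R) :
  (forall t, (1 <= t)%N -> vnorm (M ^+ t *m theta) <= B) -> bounded_orbit A v.
Proof.
move=> hB; exists (Num.max B (frob v)); case=> [|t].
  by rewrite expr0 mul1mx le_max lexx orbT.
by rewrite -cmx_orbit frob_cmx le_max hB.
Qed.

Lemma reward_dotc (eta : nat -> R) t (x : 'cV[R]_d) :
  (reward M theta eta t x)%:C%C = dotc (A ^+ t *m v) x + (eta t)%:C%C.
Proof.
rewrite /reward rmorphD; congr (_ + _); rewrite -cmx_orbit mxE rmorph_sum.
by apply: eq_bigr => i _; rewrite rmorphM !mxE.
Qed.

Lemma data_matrix_error (bs : seq C) (u : C -> 'cV[C]_d) (K0 tau : R)
    (cc : C -> C) (Kb : C -> R) (X : 'I_d -> 'cV[R]_d) :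
  0 <= K0 -> 0 <= tau < 1 ->
  (forall b, b \in bs -> normc b = 1) ->
  (forall t, frob (A ^+ t *m v - \sum_(b <- bs) b ^+ t *: u b) <= K0 * tau ^+ t) ->
  (forall b, b \in bs -> 0 <= Kb b /\ forall N,
    normc (\sum_(j < N) (b ^+ (2 * d ^ 2)) ^+ j * weyl_weight R L j - N%:R * cc b) <= Kb b) ->
  exists K : R, 0 <= K /\ forall (N : nat) (eta : nat -> R) (s : nat), (0 < N)%N ->
    frob (data_matrix M theta L N eta X s - noise_matrix d L N eta s
      - \matrix_(k < d, l < d) \sum_(b <- bs)
          cc b * b ^+ (2 * k * d + s * d + N + l.+1) * dotc (u b) (X k)) <= K / N%:R.
Proof.
move=> K00 tau01 b1 hdec hcc.
have [K1 [K10 hK1]] := geometric_le_inv tau01.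
pose x1 k := \sum_i `|X k i 0|.
have x10 k : 0 <= x1 k by apply: sumr_ge0 => i _.
pose Ke k := \sum_(b <- bs) normc (dotc (u b) (X k)) * Kb b + K0 * K1 * x1 k.
have Ke0 k : 0 <= Ke k.
  rewrite addr_ge0 ?mulr_ge0 // big_seq; apply: sumr_ge0 => b /hcc [h _].
  by rewrite mulr_ge0 ?normc_ge0.
pose Kt := \sum_k Ke k.
have Kt0 : 0 <= Kt by apply: sumr_ge0 => k _.
exists ((d * d)%:R * Kt); split; first by rewrite mulr_ge0.
move=> N eta s N0; have NR : (0 : R) < N%:R by rewrite ltr0n.
have NC : (N%:R : C) != 0 by rewrite pnatr_eq0 -lt0n.
rewrite -mulrA; apply: frob_le_entries; first by rewrite divr_ge0 // ltW.
move=> k l; pose t0 := (2 * k * d + s * d + N + l.+1)%N.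
pose tj j := (2 * k * d + s * d + 2 * d ^ 2 * j + N + l.+1)%N.
have tjE j : tj j = (t0 + 2 * d ^ 2 * j)%N by rewrite /tj /t0; lia.
pose e t := A ^+ t *m v - \sum_(b <- bs) b ^+ t *: u b.
pose w := weyl_weight R L.
pose err := \sum_(b <- bs) b ^+ t0 * dotc (u b) (X k) *
     (\sum_(j < N) (b ^+ (2 * d ^ 2)) ^+ j * w j - N%:R * cc b)
   + \sum_(j < N) dotc (e (tj j)) (X k) * w j.
have mxB3 (Y1 Y2 Y3 : 'M[C]_d) : (Y1 - Y2 - Y3) k l = Y1 k l - Y2 k l - Y3 k l.
  by rewrite !mxE.
rewrite mxB3 /data_matrix /noise_matrix 3!mxE.
have -> : (N%:R)^-1 * \sum_(j < N) (reward M theta eta (tj j) (X k))%:C%C * w j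
    - (N%:R)^-1 * \sum_(j < N) (eta (tj j))%:C%C * w j
    - \sum_(b <- bs) cc b * b ^+ t0 * dotc (u b) (X k) = (N%:R)^-1 * err.
  rewrite -mulrBr -sumrB.
  have -> : \sum_(j < N) ((reward M theta eta (tj j) (X k))%:C%C * w j - (eta (tj j))%:C%C * w j) =
      \sum_(b <- bs) b ^+ t0 * dotc (u b) (X k) * (\sum_(j < N) (b ^+ (2 * d ^ 2)) ^+ j * w j)
      + \sum_(j < N) dotc (e (tj j)) (X k) * w j.
    under [X in _ = X + _]eq_bigr do rewrite mulr_sumr.
    rewrite exchange_big -big_split /=; apply: eq_bigr => j _.
    rewrite reward_dotc mulrDl addrK.
    have -> : A ^+ tj j *m v = \sum_(b <- bs) b ^+ tj j *: u b + e (tj j).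
      by rewrite /e addrC subrK.
    rewrite dotcD mulrDl; congr (_ + _); rewrite dotc_sum mulr_suml; apply: eq_bigr => b _.
    by rewrite tjE exprD exprM; ring.
  apply: (mulfI NC); rewrite mulrBr !mulrA mulfV // !mul1r /err addrAC; congr (_ + _).
  rewrite mulr_sumr -sumrB; apply: eq_bigr => b _; ring.
rewrite normc_mul.
have -> : normc (N%:R)^-1 = (N%:R)^-1.
  by rewrite normc_inv -(rmorph_nat (real_complex R)) normc_real ger0_norm.
rewrite mulrC ler_wpM2r ?invr_ge0 //.
apply: (@le_trans _ _ (Ke k)); last first.
  by rewrite /Kt (bigD1 k) //= lerDl; apply: sumr_ge0 => k' _.
apply: le_trans (normcD_le _ _) _; apply: lerD.
  apply: le_trans (normc_sum _ _ _) _; rewrite big_seq [leRHS]big_seq; apply: ler_sum => b bbs.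
  have [Kb0 hb] := hcc b bbs.
  by rewrite !normc_mul normcX b1 // expr1n mul1r ler_wpM2l ?normc_ge0.
apply: le_trans (normc_sum _ _ _) _.
apply: (@le_trans _ _ (\sum_(j < N) (K0 * tau ^+ N * x1 k))).
  apply: ler_sum => j _; rewrite normc_mul normc_weyl mulr1.
  apply: le_trans (normc_dotc _ _) _; apply: ler_wpM2r; first exact: x10.
  apply: le_trans (hdec (tj j)) _; rewrite ler_wpM2l //.
  case/andP: tau01 => t0' t1'; apply: ler_wiXn2l => //; first exact: ltW.
  by rewrite /tj; lia.
rewrite sumr_const card_ord -mulr_natl mulrA ler_wpM2r //.
by rewrite mulrCA ler_wpM2l.
Qed.

End data_matrix.

Section recovery.
Variable R : realType.
Local Notation C := R[i].
Local Notation normc := (@Normc.normc R).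

Lemma power_rows_free n r (beta : 'I_r -> C) : (r <= n)%N -> injective beta ->
  (forall i, beta i != 0) -> row_free (\matrix_(i < r, l < n) beta i ^+ l.+1).
Proof.
move=> rn ib b0; set Q := \matrix_(_, _) _; rewrite -kermx_eq0;
  apply/eqP/row_matrixP => i0; rewrite row0.
have : row i0 (kermx Q) *m Q = 0 by rewrite -row_mul mulmx_ker row0.
move: (row i0 _) => y hy.
have hyl (l : 'I_n) : \sum_i y 0 i * beta i ^+ l.+1 = 0.
  have := congr1 (fun Z : 'rV[C]_n => Z 0 l) hy; rewrite mxE [RHS]mxE => e; rewrite -[RHS]e.
  by apply: eq_bigr => i _; rewrite [Q _ _]mxE.
apply/rowP => i; rewrite [RHS]mxE.
pose p := \prod_(j <- rem i (enum 'I_r)) ('X - (beta j)%:P).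
have sp : (size p <= n)%N.
  rewrite size_prod_XsubC size_rem ?mem_enum // size_enum_ord.
  by rewrite prednK // (leq_ltn_trans _ (ltn_ord i)).
have hp : \sum_j y 0 j * beta j * p.[beta j] = 0.
  under eq_bigr do rewrite (horner_coef_wide _ sp) mulr_sumr.
  rewrite exchange_big big1 // => l _ /=.
  have := congr1 (fun z => p`_l * z) (hyl l); rewrite mulr0 mulr_sumr => e; rewrite -[RHS]e.
  by apply: eq_bigr => j _; rewrite exprS; ring.
move: hp; rewrite (bigD1 i) //= big1 ?addr0 => [/eqP|j ji]; last first.
  rewrite /p (big_rem j) /=; last by rewrite mem_rem_uniq ?enum_uniq // inE ji mem_enum.
  by rewrite hornerM hornerXsubC subrr mul0r mulr0.
rewrite !mulf_eq0 (negbTE (b0 i)) orbF => /orP [/eqP //|].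
rewrite -rootE /p -(big_map beta predT (fun a => 'X - a%:P)) root_prod_XsubC => /mapP [j].
by rewrite mem_rem_uniq ?enum_uniq // inE => /andP [/eqP ji _] /ib /esym.
Qed.

Lemma frob_diag_mx_le r (f : 'I_r -> C) :
  frob (diag_mx (\row_i f i)) <= (r * r)%:R * \sum_i normc (f i).
Proof.
apply: frob_le_entries; first by apply: sumr_ge0 => i _; exact: normc_ge0.
move=> i j; rewrite !mxE; case: eqP => [_|_].
  by rewrite mulr1n (bigD1 i) //= lerDl; apply: sumr_ge0 => k _; exact: normc_ge0.
by rewrite mulr0n Normc.normc0; apply: sumr_ge0 => k _; exact: normc_ge0.
Qed.

Lemma recovery n (M : 'M[R]_n.+1) (theta : 'cV[R]_n.+1) (L : nat) :
  (0 < L)%N -> bounded_orbit (cmx M) (cmx theta) ->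
  exists (r : nat) (c : nat -> nat -> C) (u : nat -> 'cV[C]_n.+1),
  [/\ (r <= n.+1)%N, (forall k j, c k j != 0),
    (forall m (b : 'I_m -> C), (m <= r)%N -> \sum_j b j *: u j = 0 -> forall j, b j = 0) &
    forall X : 'I_n.+1 -> 'cV[R]_n.+1, \det (gen_mx c u (@inord n) r X) != 0 ->
    exists (T : 'M[C]_n.+1) (C0 : R),
      [/\ forall a, eigenvalue T a -> a = 0 \/ distinct_eigenvalue M theta n.+1 a, 0 < C0 &
      forall (N : nat) (g : R) (eta : nat -> R), (0 < N)%N -> 1 <= g * Num.sqrt N%:R ->
        (forall s, (s < 2)%N ->
          frob (noise_matrix n.+1 L N eta s) <= g - (2 * Num.sqrt N%:R)^-1) ->
        frob (T - data_matrix M theta L N eta X 1 *m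
          Defs.pinv (low_rank_approx g (data_matrix M theta L N eta X 0))) <= C0 * g]].
Proof.
move=> L0 hb.
have [bs [u0 [K0 [tau [[ubs K00] tau01 hbs hdec hgen]]]]] := orbit_decomposition hb.
have b1 b : b \in bs -> normc b = 1 by case/hbs.
have /choice [cc hcc] : forall b, exists c : C, b \in bs -> exists K : R, 0 <= K /\ forall N,
    normc (\sum_(j < N) (b ^+ (2 * n.+1 ^ 2)) ^+ j * weyl_weight R L j - N%:R * c) <= K.
  move=> b; case: (boolP (b \in bs)) => bbs; last by exists 0.
  have [|c [K hK]] := @weyl_average R L (b ^+ (2 * n.+1 ^ 2)) L0.
    by rewrite normcX b1 // expr1n.
  by exists c => _; exists K.
have /choice [Kb hKb] : forall b, exists K : R, b \in bs -> 0 <= K /\ forall N,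
    normc (\sum_(j < N) (b ^+ (2 * n.+1 ^ 2)) ^+ j * weyl_weight R L j - N%:R * cc b) <= K.
  move=> b; case: (boolP (b \in bs)) => bbs; last by exists 0.
  by have [K hK] := hcc b bbs; exists K.
pose gs := [seq b <- bs | cc b != 0]; pose r := size gs.
pose beta j := nth 1 gs j; pose u j := u0 (beta j).
have ugs : uniq gs by exact: filter_uniq.
have gsb b : b \in gs -> b \in bs /\ cc b != 0 by rewrite mem_filter => /andP [].
have hbeta j : (j < r)%N -> beta j \in gs by exact: mem_nth.
have beta0 j : beta j != 0.
  case: (ltnP j r) => jr; last by rewrite /beta nth_default // oner_eq0.
  by rewrite -normc_eq0 b1 ?oner_eq0 //; case: (gsb _ (hbeta _ jr)).
have indep m (b : 'I_m -> C) : (m <= r)%N -> \sum_j b j *: u j = 0 -> forall j, b j = 0.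
  move=> mr hb0 j; pose c' x := oapp b 0 (insub (index x gs)).
  have c'E (i : 'I_m) : c' (beta i) = b i.
    rewrite /c' index_uniq ?(leq_trans (ltn_ord i) mr) //.
    by rewrite insubT //= => h; congr b; apply: val_inj.
  have smt : size (take m gs) = m by rewrite size_takel.
  rewrite -c'E; apply: (@eigenvectors_independent R n (cmx M) (take m gs) u0 c').
  - exact: take_uniq.
  - by move=> x /mem_take /gsb [xb _]; case: (hbs _ xb).
  - rewrite (big_nth 1) big_mkord smt -[RHS]hb0; apply: eq_bigr => i _.
    by rewrite nth_take // -/(beta i) c'E.
  - rewrite /beta -(nth_take _ (ltn_ord j)); apply: mem_nth.
    by rewrite smt.
have rn : (r <= n.+1)%N.
  apply: (@inj_mx_leq R _ _ (\matrix_(i < n.+1, j < r) u j i 0)) => y hy.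
  apply/colP => j; rewrite [RHS]mxE; apply: (indep r (fun j => y j 0)) => //.
  apply/colP => i; have := congr1 (fun Z : 'cV[C]_n.+1 => Z i 0) hy.
  rewrite mxE => e; rewrite summxE -[RHS]e; apply: eq_bigr => k _.
  by rewrite !mxE mulrC.
exists r, (fun k j => beta j ^+ (2 * k * n.+1)), u; split => //.
  by move=> k j; rewrite expf_neq0.
move=> X hdet.
pose P : 'M[C]_(n.+1, r) := \matrix_(k, i) (beta i ^+ (2 * k * n.+1) * dotc (u i) (X k)).
have hP (y : 'cV_r) : P *m y = 0 -> y = 0.
  move=> hy; set G := gen_mx _ _ _ _ _ in hdet.
  have Gu : G \in unitmx by rewrite unitmxE unitfE.
  have Gy : G *m y = 0.
    apply/colP => k; rewrite [RHS]mxE.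
    have := congr1 (fun Z : 'cV[C]_n.+1 => Z (inord k) 0) hy.
    rewrite mxE [RHS]mxE => e; rewrite mxE -[RHS]e; apply: eq_bigr => i _.
    by rewrite [G _ _]mxE [P _ _]mxE inordK // (leq_trans (ltn_ord k)).
  by rewrite -[y](mulKmx Gu) Gy mulmx0.
pose Q : 'M[C]_(r, n.+1) := \matrix_(i, l) beta i ^+ l.+1.
have binj : injective (fun i : 'I_r => beta i).
  by move=> i j /eqP; rewrite nth_uniq // => /eqP /val_inj.
have Qfree : row_free Q by apply: (power_rows_free rn binj).
have hQ : Q *m pinvmx Q = 1%:M by exact: mulmxVp.
pose rho (i : 'I_r) := beta i ^+ n.+1.
pose Lam := diag_mx (\row_i rho i).
pose f N (i : 'I_r) := cc (beta i) * beta i ^+ N.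
have nb N (i : 'I_r) : normc (beta i ^+ N) = 1.
  by rewrite normcX b1 ?expr1n //; case: (gsb _ (hbeta _ (ltn_ord i))).
have f0 N i : f N i != 0.
  by rewrite mulf_neq0 ?expf_neq0 //; case: (gsb _ (hbeta _ (ltn_ord i))).
pose kD := (r * r)%:R * \sum_(i < r) (normc (cc (beta i)) + normc (cc (beta i))^-1).
have kD0 : 0 <= kD.
  by rewrite mulr_ge0 // sumr_ge0 // => i _; rewrite addr_ge0 ?normc_ge0.
have [K [Kge0 hK]] := data_matrix_error X K00 tau01 b1 hdec hKb.
have [C0 C00 hC0] := perturbation_bound Lam hP hQ kD0 Kge0.
exists (P *m Lam *m pleft P), C0; split => //.
  move=> a /(eigenvalue_split hP) [->|[i ->]]; [by left|right].
  have [bbs _] := gsb _ (hbeta _ (ltn_ord i)).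
  have [nb1 heig hn0] := hbs _ bbs.
  have [hspan hcomp] := hgen _ bbs.
  split; last exact: hcomp.
    exists (u0 (beta i)); split => //.
    exact: eigen_iter.
  by rewrite /rho nb.
move=> N g eta N0 hg hnoise.
pose D := diag_mx (\row_i f N i); pose D' := diag_mx (\row_i (f N i)^-1).
have hD : D *m D' = 1%:M.
  rewrite mulmx_diag; apply/matrixP => i j; rewrite !mxE.
  by case: eqP => [->|_]; rewrite ?mulr1n ?mulr0n // mulfV.
have PDQ (s : nat) (Ls : 'M[C]_r) : (forall i j, Ls i j = (rho i ^+ s) *+ (i == j)) ->
    P *m Ls *m D *m Q = \matrix_(k < n.+1, l < n.+1) \sum_(b <- bs)
          cc b * b ^+ (2 * k * n.+1 + s * n.+1 + N + l.+1) * dotc (u0 b) (X k).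
  move=> hLs; apply/matrixP => k l; rewrite [RHS]mxE.
  have -> : \sum_(b <- bs) cc b * b ^+ (2 * k * n.+1 + s * n.+1 + N + l.+1) * dotc (u0 b) (X k) =
     \sum_(b <- gs) cc b * b ^+ (2 * k * n.+1 + s * n.+1 + N + l.+1) * dotc (u0 b) (X k).
    rewrite big_filter [RHS]big_mkcond; apply: eq_bigr => b _.
    by case: eqP => [->|//]; rewrite !mul0r.
  rewrite (big_nth 1) big_mkord mxE; apply: eq_bigr => i _.
  have -> : (P *m Ls *m D) k i = (P *m Ls) k i * f N i by rewrite mul_mx_diag !mxE.
  rewrite [Q _ _]mxE.
  have -> : (P *m Ls) k i = P k i * rho i ^+ s.
    rewrite mxE (bigD1 i) //= big1 ?addr0 => [|j ji]; first by rewrite hLs eqxx mulr1n.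
    by rewrite hLs (negbTE ji) mulr0n mulr0.
  rewrite [P _ _]mxE /f /rho -/(beta i) -/(u i) !exprD [(s * n.+1)%N]mulnC (exprM _ n.+1 s).
  by ring.
have PDQ0 : P *m D *m Q = \matrix_(k < n.+1, l < n.+1) \sum_(b <- bs)
      cc b * b ^+ (2 * k * n.+1 + 0 * n.+1 + N + l.+1) * dotc (u0 b) (X k).
  by rewrite -(PDQ 0%N 1%:M) ?mulmx1 // => i j; rewrite mxE expr0.
have PDQ1 : P *m Lam *m D *m Q = \matrix_(k < n.+1, l < n.+1) \sum_(b <- bs)
      cc b * b ^+ (2 * k * n.+1 + 1 * n.+1 + N + l.+1) * dotc (u0 b) (X k).
  by rewrite (PDQ 1%N) // => i j; rewrite !mxE expr1.
have hE s : (s < 2)%N -> forall G : 'M[C]_n.+1, G = \matrix_(k < n.+1, l < n.+1) \sum_(b <- bs)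
      cc b * b ^+ (2 * k * n.+1 + s * n.+1 + N + l.+1) * dotc (u0 b) (X k) ->
    frob (data_matrix M theta L N eta X s - G) <= g - (2 * Num.sqrt N%:R)^-1 + K / N%:R.
  move=> s2 G ->; have := hK N eta s N0; have := hnoise s s2.
  move: (data_matrix _ _ _ _ _ _ _) (noise_matrix _ _ _ _ _) (\matrix_(_, _) _) => Y1 Y2 Y3 h1 h2.
  have -> : Y1 - Y3 = Y2 + (Y1 - Y2 - Y3) by rewrite addrA addrCA subrr addr0.
  by apply: le_trans (frobD _ _) _; exact: lerD.
have := hC0 N g D D' _ _ N0 hD _ _ hg (hE 0%N isT _ PDQ0) (hE 1%N isT _ PDQ1).
rewrite [P *m D *m Q + _]addrC subrK [P *m Lam *m D *m Q + _]addrC subrK; apply.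
  apply: le_trans (frob_diag_mx_le _) _; rewrite ler_wpM2l //.
  by apply: ler_sum => i _; rewrite normc_mul nb mulr1 lerDl normc_ge0.
apply: le_trans (frob_diag_mx_le _) _; rewrite ler_wpM2l //.
by apply: ler_sum => i _; rewrite normc_inv normc_mul nb mulr1 -normc_inv lerDr normc_ge0.
Qed.

End recovery.

Section final.
Variable R : realType.

Lemma threshold_le d (sigma delta : R) (N : nat) : (0 < d)%N -> 0 <= sigma ->
  0 < delta <= 1 ->
  threshold d sigma delta N <= (ln (4 * d%:R ^+ 2) + d%:R ^+ 2 + 2) *
    ((sigma ^+ 2 * (ln (1 / delta) + 1) + 1) / Num.sqrt N%:R).
Proof.
move=> d0 sg0 /andP [de0 de1]; rewrite /threshold mulrA.
rewrite ler_wpM2r ?invr_ge0 ?sqrtr_ge0 //.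
have d1 : (1 : R) <= d%:R ^+ 2 by rewrite expr_ge1 // ler1n.
have q4 : (1 : R) <= 4 * d%:R ^+ 2.
  by apply: le_trans d1 _; rewrite ler_peMl ?sqr_ge0 // ler1n.
have a0 : 0 <= ln (4 * d%:R ^+ 2) :> R by rewrite ln_ge0.
have b0 : 0 <= ln (1 / delta) by rewrite ln_ge0 // div1r invf_ge1.
have -> : 4 * d%:R ^+ 2 / delta = 4 * d%:R ^+ 2 * (1 / delta) by rewrite div1r.
rewrite (@lnM _ (4 * d%:R ^+ 2)) ?posrE ?divr_gt0 ?(lt_le_trans ltr01 q4) //.
have -> : 4 * d%:R ^+ 2 * sigma ^+ 2 * (ln (4 * d%:R ^+ 2) + ln (1 / delta)) =
    (2 * d%:R * sigma) ^+ 2 * (ln (4 * d%:R ^+ 2) + ln (1 / delta)) by ring.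
set a := ln (4 * _) in a0 *; set b := ln (1 / delta) in b0 *.
rewrite sqrtrM ?sqr_ge0 // sqrtr_sqr ger0_norm ?mulr_ge0 //.
have hab : a + b <= (a + 1) * (b + 1).
  by rewrite -subr_ge0 (_ : _ - _ = a * b + 1); [rewrite addr_ge0 // mulr_ge0|ring].
have s2 : Num.sqrt (a + b) ^+ 2 = a + b by rewrite sqr_sqrtr // addr_ge0.
have h1 : 2 * d%:R * sigma * Num.sqrt (a + b) <= d%:R ^+ 2 + sigma ^+ 2 * (a + b).
  rewrite -[in leRHS]s2; move: (Num.sqrt (a + b)) => y; rewrite -subr_ge0.
  by rewrite (_ : _ - _ = (d%:R - sigma * y) ^+ 2) ?sqr_ge0 //; ring.
apply: (@le_trans _ _ (d%:R ^+ 2 + sigma ^+ 2 * ((a + 1) * (b + 1)) + 1)).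
  rewrite lerD2r; apply: le_trans h1 _; rewrite lerD2l ler_wpM2l ?sqr_ge0 //.
rewrite -subr_ge0.
rewrite (_ : _ - _ = (d%:R ^+ 2 + 1) * (sigma ^+ 2 * (b + 1)) + a + 1); last by ring.
by rewrite !addr_ge0 // mulr_ge0 ?addr_ge0 ?sqr_ge0 // mulr_ge0 ?sqr_ge0 ?addr_ge0.
Qed.

Lemma threshold_ge1 d (sigma delta : R) (N : nat) : (0 < N)%N ->
  1 <= threshold d sigma delta N * Num.sqrt N%:R.
Proof.
move=> N0; rewrite /threshold divfK ?gt_eqF ?sqrtr_gt0 ?ltr0n //.
by rewrite lerDr sqrtr_ge0.
Qed.

End final.

Theorem theorem2 (R : realType) (d : nat) (d_gt0 : (0 < d)%N)
    (M : 'M[R]_d) (theta : 'cV[R]_d) (L : nat) (L_gt0 : (0 < L)%N) :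
  exists2 C : ('I_d -> 'cV[R]_d) -> R, (forall X, 0 < C X) &
  forall (D : set 'cV[R]_d) (sigma B mu Delta delta : R) (t0 N : nat)
    (J : 'M[R[i]]_d)
    (dO : measure_display) (Omega : measurableType dO) (P : probability Omega R)
    (F : nat -> set (set Omega)) (x : nat -> Omega -> 'cV[R]_d)
    (eta : nat -> Omega -> R) (xt : 'I_d -> Omega -> 'cV[R]_d),
  (exists b : R, forall v, D v -> vnorm v <= b) ->
  @unit_sphere R d `<=` D ->
  (forall t w, (1 <= t)%N -> D (x t w)) ->
  0 <= sigma ->
  cond_subgaussian P F sigma x eta ->
  0 < B ->
  (forall t, (1 <= t)%N -> vnorm (M ^+ t *m theta) <= B) ->
  (0 < t0)%N -> 0 <= mu ->
  nearly_periodic (fun s => M ^+ (t0 + s - 1) *m theta) mu L ->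
  is_jordan_form (cmx M) J ->
  0 < Delta <= 1 ->
  (forall a, eigenvalue (cmx M) a -> Normc.normc a < 1 ->
     Normc.normc a <= 1 - Delta) ->
  0 < delta <= 1 ->
  (2 * d ^ 2 <= N)%N ->
  Num.max (16 * L%:R ^+ 2)
    (- (d%:R - 1) * ln Delta / Delta
     + (ln (B * kappa (cmx M) J ^+ 2) + d%:R + 6) / Delta + d%:R) <= N%:R ->
  independent_vecs P xt ->
  (forall m, uniform_sphere P (xt m)) ->
  exploration N x xt ->
  exists A : ('I_d -> 'cV[R]_d) -> 'M[R[i]]_d,
    (forall X a, eigenvalue (A X) a ->
       a = 0 \/ distinct_eigenvalue M theta d a) /\
    exists E : set Omega,
      [/\ measurable E, ((1 - delta)%:E <= P E)%E &
          forall w, E w ->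
            let X := fun m => xt m w in
            spectral_norm
              (A X - algorithm_output M theta L N sigma delta
                       (fun t => eta t w) X)
            <= C X * ((sigma ^+ 2 * (ln (1 / delta) + 1) + 1) / Num.sqrt N%:R)].
Proof.
case: d d_gt0 M theta => [//|n] d_gt0 M theta.
have [[B0 hB0]|nob] := pselect (exists B : R, forall t, (1 <= t)%N -> vnorm (M ^+ t *m
  theta) <= B); last first.
  exists (fun=> 1) => // D sigma B mu Delta delta t0 N J dO Omega P F x eta xt.
  by move=> _ _ _ _ _ _ hB; case: nob; exists B.
have [r [c [u [rn hc hu hX]]]] := recovery L_gt0 (bounded_orbit_cmx hB0).
pose gen X := \det (gen_mx c u (@inord n) r X) != 0.
have /choice [TC hTC] : forall X : 'I_n.+1 -> 'cV[R]_n.+1, exists TC : 'M[R[i]]_n.+1 * R,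
   [/\ forall a, eigenvalue TC.1 a -> a = 0 \/ distinct_eigenvalue M theta n.+1 a, 0 < TC.2 &
   gen X -> forall (N : nat) (g : R) (eta : nat -> R), (0 < N)%N -> 1 <= g * Num.sqrt N%:R ->
        (forall s, (s < 2)%N ->
          frob (noise_matrix n.+1 L N eta s) <= g - (2 * Num.sqrt N%:R)^-1) ->
        frob (TC.1 - data_matrix M theta L N eta X 1 *m
          Defs.pinv (low_rank_approx g (data_matrix M theta L N eta X 0))) <= TC.2 * g].
  move=> X; case: (boolP (gen X)) => [gX|_].
    by have [T [C0 [h1 h2 h3]]] := hX X gX; exists (T, C0); split.
  exists (0, 1); split => // a /eigenvalueP [w hw w0]; left.
  by move: hw; rewrite mulmx0 => /esym/eqP; rewrite scaler_eq0 (negbTE w0) orbF => /eqP.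
pose kap : R := ln (4 * n.+1%:R ^+ 2) + n.+1%:R ^+ 2 + 2.
have kap0 : 0 < kap.
  rewrite ltr_wpDl // addr_ge0 ?sqr_ge0 // ln_ge0 //.
  rewrite -natrX -natrM ler1n muln_gt0 expn_gt0 //.
exists (fun X => (TC X).2 * kap) => [X|]; first by rewrite mulr_gt0 //; case: (hTC X).
move=> D sigma B mu Delta delta t0 N J dO Omega P F x eta xt.
move=> _ _ _ sg0 hsub _ _ _ _ _ _ _ _ hdelta hN _ hind hunif _.
exists (fun X => (TC X).1); split=> [X|]; first by case: (hTC X).
have N0 : (0 < N)%N by apply: leq_trans hN; rewrite muln_gt0 expn_gt0.
have [E [mE PE hE]] := noise_event L d_gt0 N0 sg0 hsub hdelta.
have [|mG PG] := generic_gen_mx hind hunif hc hu _ (leqnn r) (idx := @inord n).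
  move=> i j ir jr /(congr1 val) /=.
  by rewrite !inordK // (leq_trans _ rn).
set G := [set w | _] in mG PG.
exists (E `\` G); split.
- exact: measurableD.
- apply: le_trans PE _.
  have hEG : E `<=` (E `\` G) `|` G.
    by move=> w Ew; case: (pselect (G w)) => Gw; [right|left].
  apply: (@le_trans _ _ (P ((E `\` G) `|` G))).
    by apply: le_measure => //; rewrite inE //; apply: measurableU => //; exact: measurableD.
  rewrite -[leRHS]adde0 -PG; apply: measureU2 => //; exact: measurableD.
move=> w [Ew /eqP Gw] /=; have [_ _ /(_ Gw)] := hTC (fun m => xt m w).
move=> /(_ N (threshold n.+1 sigma delta N) (eta ^~ w) N0 (threshold_ge1 _ _ _ N0)) h.
apply: le_trans (spectral_norm_frob _ d_gt0) _.
apply: le_trans (h (hE w Ew)) _; rewrite -mulrA ler_wpM2l //.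
  by apply: ltW; case: (hTC (fun m => xt m w)).
exact: threshold_le.
Qed.
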